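(* Let $X$ and $Y$ be locally compact spaces, neither of which is pseudocompact. If $(\mathscr{U}(X),\leq)$ and $(\mathscr{U}(Y),\leq)$ are order-isomorphic, then $(\beta X\setminus X)\setminus\mathrm{cl}_{\beta X}(\beta X\setminus\upsilon X)$ and $(\beta Y\setminus Y)\setminus\mathrm{cl}_{\beta Y}(\beta Y\setminus\upsilon Y)$ are homeomorphic.
   Context: All spaces are completely regular Hausdorff. $\beta X$ is the Stone–Čech compactification and $\upsilon X\subseteq\beta X$ the Hewitt realcompactification of $X$. An extension of $X$ is a space containing $X$ as a dense subspace; its remainder is $Y\setminus X$. Extensions are identified up to homeomorphisms fixing $X$ pointwise, and $Y\leq Y'$ means there is a continuous map $Y'\to Y$ fixing $X$ pointwise. A space is pseudocompact if every continuous real-valued function on it is bounded. $\mathscr{U}(X)$ denotes the set of all pseudocompact extensions of $X$ with compact remainder, partially ordered by $\leq$. *)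

(* Defs.v *)
From Stdlib Require Import Reals Lra List Classical.
Open Scope R_scope.

Record Space : Type := {
  pt :> Type;
  is_open : (pt -> Prop) -> Prop;
  open_full : is_open (fun _ => True);
  open_inter : forall U V, is_open U -> is_open V -> is_open (fun x => U x /\ V x);
  open_union : forall F : (pt -> Prop) -> Prop,
      (forall U, F U -> is_open U) -> is_open (fun x => exists U, F U /\ U x)
}.
Arguments is_open {s} _.

Definition R_open (U : R -> Prop) : Prop :=
  forall x, U x -> exists eps, eps > 0 /\ forall y, Rabs (y - x) < eps -> U y.

Lemma R_open_full : R_open (fun _ => True).
Proof. intros x _; exists 1; split; [lra | auto]. Qed.

Lemma R_open_inter : forall U V, R_open U -> R_open V -> R_open (fun x => U x /\ V x).
Proof.
  intros U V HU HV x [Ux Vx].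
  destruct (HU x Ux) as [e1 [He1 H1]]; destruct (HV x Vx) as [e2 [He2 H2]].
  exists (Rmin e1 e2); split; [apply Rmin_pos; lra|].
  intros y Hy; split; [apply H1 | apply H2];
    eapply Rlt_le_trans; eauto; [apply Rmin_l | apply Rmin_r].
Qed.

Lemma R_open_union : forall F : (R -> Prop) -> Prop,
  (forall U, F U -> R_open U) -> R_open (fun x => exists U, F U /\ U x).
Proof.
  intros F HF x [U [FU Ux]].
  destruct (HF U FU x Ux) as [e [He H]].
  exists e; split; auto. intros y Hy; exists U; auto.
Qed.

Definition R_space : Space := {|
  pt := R; is_open := R_open; open_full := R_open_full;
  open_inter := R_open_inter; open_union := R_open_union |}.

Definition sub_open (S : Space) (A : S -> Prop) (V : {x : S | A x} -> Prop) : Prop :=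
  exists U, is_open U /\ forall z, V z <-> U (proj1_sig z).

Lemma sub_open_full S A : sub_open S A (fun _ => True).
Proof. exists (fun _ => True); split; [apply open_full | tauto]. Qed.

Lemma sub_open_inter S A : forall U V, sub_open S A U -> sub_open S A V ->
  sub_open S A (fun x => U x /\ V x).
Proof.
  intros U V [U' [HU' EU]] [V' [HV' EV]].
  exists (fun x => U' x /\ V' x); split; [apply open_inter; auto|].
  intro z; rewrite EU, EV; tauto.
Qed.

Lemma sub_open_union S A : forall F, (forall U, F U -> sub_open S A U) ->
  sub_open S A (fun x => exists U, F U /\ U x).
Proof.
  intros F HF.
  exists (fun x => exists W, (is_open W /\ exists V, F V /\ forall z, V z <-> W (proj1_sig z)) /\ W x).
  split.
  - apply open_union; intros W [HW _]; exact HW.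
  - intro z; split.
    + intros [V [FV Vz]]. destruct (HF V FV) as [W [HW EW]].
      exists W; split; [split; [exact HW | exists V; auto] | apply EW; exact Vz].
    + intros [W [[HW [V [FV EV]]] Wz]]. exists V; split; auto. apply EV; exact Wz.
Qed.

Definition sub (S : Space) (A : S -> Prop) : Space := {|
  pt := {x : S | A x}; is_open := sub_open S A; open_full := sub_open_full S A;
  open_inter := sub_open_inter S A; open_union := sub_open_union S A |}.

Definition continuous {S T : Space} (f : S -> T) : Prop :=
  forall V : T -> Prop, is_open V -> is_open (fun x => V (f x)).

Definition closed (S : Space) (F : S -> Prop) : Prop := is_open (fun x => ~ F x).

Definition closure (S : Space) (A : S -> Prop) (x : S) : Prop :=
  forall U : S -> Prop, is_open U -> U x -> exists y, U y /\ A y.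

Definition Hausdorff (S : Space) : Prop :=
  forall x y : S, x <> y -> exists U V : S -> Prop,
    is_open U /\ is_open V /\ U x /\ V y /\ forall z, ~ (U z /\ V z).

Definition completely_regular (S : Space) : Prop :=
  forall (F : S -> Prop) (x : S), closed S F -> ~ F x ->
    exists f : S -> R_space, continuous f /\ f x = 0 /\ forall y, F y -> f y = 1.

Definition Tychonoff (S : Space) : Prop := Hausdorff S /\ completely_regular S.

Definition compact (S : Space) : Prop :=
  forall F : (S -> Prop) -> Prop,
    (forall U, F U -> is_open U) -> (forall x, exists U, F U /\ U x) ->
    exists l : list (S -> Prop), (forall U, In U l -> F U) /\
                                 (forall x, exists U, In U l /\ U x).

Definition locally_compact (S : Space) : Prop :=
  forall x : S, exists U : S -> Prop, is_open U /\ U x /\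
    exists K : S -> Prop, compact (sub S K) /\ forall y, U y -> K y.

Definition pseudocompact (S : Space) : Prop :=
  forall f : S -> R_space, continuous f -> exists M, forall x, Rabs (f x) <= M.

Definition embedding {S T : Space} (e : S -> T) : Prop :=
  continuous e /\ (forall x y, e x = e y -> x = y) /\
  forall U : S -> Prop, is_open U -> exists V : T -> Prop, is_open V /\ forall x, U x <-> V (e x).

Definition dense_map {S T : Space} (e : S -> T) : Prop :=
  forall V : T -> Prop, is_open V -> (exists y, V y) -> exists x, V (e x).

Definition homeomorphic (S T : Space) : Prop :=
  exists (f : S -> T) (g : T -> S), continuous f /\ continuous g /\
    (forall x, g (f x) = x) /\ (forall y, f (g y) = y).

Record Ext (X : Space) := {
  ext_sp : Space;
  ext_map : X -> ext_sp;
  ext_embedding : embedding ext_map;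
  ext_dense : dense_map ext_map;
  ext_tychonoff : Tychonoff ext_sp
}.
Arguments ext_sp {X} _.
Arguments ext_map {X} _ _.

Definition remainder {X : Space} (E : Ext X) : ext_sp E -> Prop :=
  fun y => ~ exists x, ext_map E x = y.

Definition in_U {X : Space} (E : Ext X) : Prop :=
  pseudocompact (ext_sp E) /\ compact (sub (ext_sp E) (remainder E)).

Definition ext_le {X : Space} (E1 E2 : Ext X) : Prop :=
  exists h : ext_sp E2 -> ext_sp E1, continuous h /\
    forall x, h (ext_map E2 x) = ext_map E1 x.

Definition ext_equiv {X : Space} (E1 E2 : Ext X) : Prop :=
  exists (h : ext_sp E1 -> ext_sp E2) (k : ext_sp E2 -> ext_sp E1),
    continuous h /\ continuous k /\ (forall y, k (h y) = y) /\ (forall y, h (k y) = y) /\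
    forall x, h (ext_map E1 x) = ext_map E2 x.

(* (U(X), <=) and (U(Y), <=) order-isomorphic: an order isomorphism between the
   posets of equivalence classes, presented on representatives. *)
Definition U_order_isomorphic (X Y : Space) : Prop :=
  exists F : Ext X -> Ext Y,
    (forall E, in_U E -> in_U (F E)) /\
    (forall E1 E2, in_U E1 -> in_U E2 -> (ext_equiv E1 E2 <-> ext_equiv (F E1) (F E2))) /\
    (forall E1 E2, in_U E1 -> in_U E2 -> (ext_le E1 E2 <-> ext_le (F E1) (F E2))) /\
    (forall E', in_U E' -> exists E, in_U E /\ ext_equiv (F E) E').

(* (K, e) is a Stone-Cech compactification of X: a compactification in which
   X is C*-embedded (characterizes beta X up to homeomorphism fixing X). *)
Definition stone_cech (X K : Space) (e : X -> K) : Prop :=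
  compact K /\ Hausdorff K /\ embedding e /\ dense_map e /\
  forall f : X -> R_space, continuous f -> (exists M, forall x, Rabs (f x) <= M) ->
    exists g : K -> R_space, continuous g /\ forall x, g (e x) = f x.

(* p in upsilon X (inside beta X = K): every continuous real function on X
   extends continuously to X u {p}. *)
Definition in_hewitt (X K : Space) (e : X -> K) (p : K) : Prop :=
  forall f : X -> R_space, continuous f ->
    exists g : sub K (fun q => q = p \/ exists x, e x = q) -> R_space,
      continuous g /\ forall x h, g (exist _ (e x) h) = f x.

Definition target_set (X K : Space) (e : X -> K) : K -> Prop :=
  fun p => (~ exists x, e x = p) /\ ~ closure K (fun q => ~ in_hewitt X K e q) p.

(* Main.v *)
Require Import Defs.
From Stdlib Require Import Reals List Classical.
From Stdlib Require Import ZArith Lra Lia ClassicalEpsilon FunctionalExtensionality PropExtensionality.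
(* [Reals] exports [compact] and other notions on the real line with the names of [Defs]. *)
Import Defs.

(** Let [Q] be the closure of beta X minus upsilon X. An extension of [X] is determined, with the
    order reversed into inclusion, by the partial equivalence relation on beta X minus [X] given by
    the partial map from beta X to the extension. For members of U(X) the domain of this relation
    is closed (compact remainder) and contains [Q] (pseudocompactness); conversely, every closed
    [D] with Q <= D <= beta X minus X, with at most one pair of its points glued, arises this way.
    The minimal relation is equality on [Q]. The minimal nontrivial ones either add a point
    [p] outside [Q] or glue two points of [Q]; only for the former is there a relation (gluing [p]
    to a point of the nonempty set [Q]) below which there is nothing else. So the order knows the
    points of the target set, and the points lying below a given relation are exactly those of its
    domain, so it knows the closed sets as well. *)


(** * Open sets and compactness *)

(** Adding a point and gluing two points are told apart as follows. A relation strictly containing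
    the gluing of a pair a, b of [Q] contains a further point or a further pair; either of these
    alone, on top of equality on [Q], again comes from a member of U(X), and it is incomparable with
    the gluing of a and b. So nothing larger has only a three-element chain below it. Inside the
    gluing of p to a point of [Q] there are only equality on [Q], equality on [Q] with p added, and
    the gluing itself. Local compactness makes X open in beta X, so that [Q] misses X; failure of
    pseudocompactness makes [Q] nonempty. The Stone-Cech property extends bounded functions only. An
    unbounded f is therefore handled through 1/(1+|f|), whose extension vanishes where |f| becomes
    infinite. *)

Lemma open_ext {S : Space} (U V : S -> Prop) :
  is_open U -> (forall x, U x <-> V x) -> is_open V.
Proof.
  intros HU E. replace V with U; auto.
  apply functional_extensionality; intro x; apply propositional_extensionality, E.
Qed.

Lemma open_local {S : Space} (U : S -> Prop) :
  (forall x, U x -> exists V, is_open V /\ V x /\ forall y, V y -> U y) -> is_open U.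
Proof.
  intro H.
  apply (open_ext (fun x => exists V, (is_open V /\ forall y, V y -> U y) /\ V x)).
  - apply open_union; tauto.
  - intro x; split.
    + intros (V & (_ & HV) & Vx); auto.
    + intro Ux; destruct (H x Ux) as (V & HV & Vx & VU); exists V; auto.
Qed.

Lemma open_empty {S : Space} : is_open (fun _ : S => False).
Proof. apply open_local; tauto. Qed.

Lemma open_union2 {S : Space} (U V : S -> Prop) :
  is_open U -> is_open V -> is_open (fun x => U x \/ V x).
Proof.
  intros HU HV; apply open_local; intros x [Ux|Vx]; [exists U | exists V]; auto.
Qed.

Lemma open_const {S : Space} (P : Prop) : is_open (fun _ : S => P).
Proof.
  apply open_local; intros x p; exists (fun _ => True); repeat split; auto; apply open_full.
Qed.

Lemma not_closure_nbhd {S : Space} (F : S -> Prop) x :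
  ~ closure S F x -> exists U, is_open U /\ U x /\ forall y, U y -> ~ F y.
Proof.
  intro H; apply NNPP; intro N; apply H; intros U HU Ux; apply NNPP; intro M.
  apply N; exists U; repeat split; auto; intros y Uy Fy; apply M; exists y; auto.
Qed.

Lemma closed_closure {S : Space} (F : S -> Prop) : closed S (closure S F).
Proof.
  apply open_local; intros x Hx.
  destruct (not_closure_nbhd F x Hx) as (U & HU & Ux & UF).
  exists U; repeat split; auto; intros y Uy Cy.
  destruct (Cy U HU Uy) as (z & Uz & Fz); exact (UF z Uz Fz).
Qed.

Lemma closed_union2 {S : Space} (F G : S -> Prop) :
  closed S F -> closed S G -> closed S (fun x => F x \/ G x).
Proof.
  intros HF HG; apply (open_ext (fun x => ~ F x /\ ~ G x)); [apply open_inter; auto | tauto].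
Qed.

Lemma closed_point {S : Space} (p : S) : Hausdorff S -> closed S (fun z => z = p).
Proof.
  intro H; apply open_local; intros x N.
  destruct (H x p N) as (U & V & HU & HV & Ux & Vp & D).
  exists U; repeat split; auto; intros y Uy E; subst; apply (D p); auto.
Qed.

(** Compactness as an induction principle. Finite-subcover arguments below become a choice of [Phi],
    usually separation from something fixed. *)
Lemma compact_ideal (S : Space) (K : S -> Prop) (Phi : (S -> Prop) -> Prop) :
  compact (sub S K) -> Phi (fun _ => False) ->
  (forall U V, Phi U -> Phi V -> Phi (fun x => U x \/ V x)) ->
  (forall x, K x -> exists U, is_open U /\ U x /\ Phi U) ->
  exists U, is_open U /\ Phi U /\ forall x, K x -> U x.
Proof.
  intros HK P0 PU HP.
  destruct (HK (fun V => exists U, (is_open U /\ Phi U) /\ forall z, V z <-> U (proj1_sig z)))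
    as (l & Hl & Cl).
  - intros V (U & (HU & _) & E); exists U; auto.
  - intros [x Kx]; destruct (HP x Kx) as (U & HU & Ux & PhU).
    exists (fun z => U (proj1_sig z)); split; [exists U; split; [auto | tauto] | exact Ux].
  - assert (G : exists U, is_open U /\ Phi U /\
              forall V, In V l -> forall z : sub S K, V z -> U (proj1_sig z)).
    { clear Cl; induction l as [|V l IH].
      - exists (fun _ => False); split; [apply open_empty | split; [auto | intros V []]].
      - destruct IH as (U & HU & PhU & C); [intros; apply Hl; right; auto|].
        destruct (Hl V (or_introl eq_refl)) as (U' & (HU' & PhU') & E).
        exists (fun x => U' x \/ U x); repeat split; auto; [apply open_union2; auto|].
        intros W [<-|HW] z Wz; [left; apply E; auto | right; eapply C; eauto]. }
    destruct G as (U & HU & PhU & C); exists U; repeat split; auto.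
    intros x Kx; destruct (Cl (exist _ x Kx)) as (V & HV & Vx); apply (C V HV _ Vx).
Qed.

Lemma closed_compact (S : Space) (F : S -> Prop) :
  compact S -> closed S F -> compact (sub S F).
Proof.
  intros HS HF G GO GC.
  destruct (HS (fun U => is_open U /\ ((forall x, U x -> ~ F x) \/
              exists V, G V /\ forall z, V z <-> U (proj1_sig z)))) as (l & Hl & Cl).
  - tauto.
  - intro x; destruct (classic (F x)) as [Fx|Nx].
    + destruct (GC (exist _ x Fx)) as (V & GV & Vx).
      destruct (GO V GV) as (U & HU & E).
      exists U; split; [split; auto; right; exists V; auto | apply (E (exist _ x Fx)); auto].
    + exists (fun x => ~ F x); split; auto.
  - assert (H : exists l', (forall V, In V l' -> G V) /\
       forall U, In U l -> forall z : sub S F, U (proj1_sig z) -> exists V, In V l' /\ V z).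
    { clear Cl; induction l as [|U l IH].
      - exists nil; split; [intros V [] | intros U []].
      - destruct IH as (l' & H1 & H2); [intros; apply Hl; right; auto|].
        destruct (Hl U (or_introl eq_refl)) as [HU [D | (V & GV & E)]].
        + exists l'; split; auto; intros W [<-|HW] z Wz; [|eapply H2; eauto].
          destruct (D _ Wz (proj2_sig z)).
        + exists (V :: l'); split.
          * intros W [<-|HW]; auto.
          * intros W [<-|HW] z Wz; [exists V; split; [left; auto | apply E; auto]|].
            destruct (H2 W HW z Wz) as (V' & I & V'z); exists V'; split; [right|]; auto. }
    destruct H as (l' & H1 & H2); exists l'; split; auto.
    intro z; destruct (Cl (proj1_sig z)) as (U & I & Uz); eauto.
Qed.

(* [rel] plays the role of a continuous surjection from [S] onto [T]. *)
Lemma compact_image (S T : Space) (rel : S -> T -> Prop) :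
  compact S -> (forall t, exists s, rel s t) -> (forall s, exists t, rel s t) ->
  (forall s t V, rel s t -> is_open V -> V t ->
     exists U, is_open U /\ U s /\ forall s' t', U s' -> rel s' t' -> V t') ->
  compact T.
Proof.
  intros HS Hsurj Htot Hcont G GO GC.
  destruct (HS (fun U => is_open U /\ exists V, G V /\ forall s t, U s -> rel s t -> V t))
    as (l & Hl & Cl).
  - tauto.
  - intro s; destruct (Htot s) as (t & st); destruct (GC t) as (V & GV & Vt).
    destruct (Hcont s t V st (GO V GV) Vt) as (U & HU & Us & C).
    exists U; split; auto; split; auto; exists V; auto.
  - assert (H : exists l', (forall V, In V l' -> G V) /\
       forall U, In U l -> forall s t, U s -> rel s t -> exists V, In V l' /\ V t).
    { clear Cl; induction l as [|U l IH].
      - exists nil; split; [intros V [] | intros U []].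
      - destruct IH as (l' & H1 & H2); [intros; apply Hl; right; auto|].
        destruct (Hl U (or_introl eq_refl)) as [HU (V & GV & E)].
        exists (V :: l'); split.
        + intros W [<-|HW]; auto.
        + intros W [<-|HW] s t Ws st; [exists V; split; [left; auto | eapply E; eauto]|].
          destruct (H2 W HW s t Ws st) as (V' & I & V't); exists V'; split; [right|]; auto. }
    destruct H as (l' & H1 & H2); exists l'; split; auto.
    intro t; destruct (Hsurj t) as (s & st); destruct (Cl s) as (U & I & Us); eauto.
Qed.

Lemma compact_closed (S : Space) (K : S -> Prop) :
  Hausdorff S -> compact (sub S K) -> closed S K.
Proof.
  intros HS HK; apply open_local; intros x Nx.
  destruct (compact_ideal S K (fun U => exists W, is_open W /\ W x /\ forall z, U z -> ~ W z) HK)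
    as (U & HU & (W & HW & Wx & D) & C).
  - exists (fun _ => True); repeat split; [apply open_full | tauto].
  - intros U V (W & HW & Wx & D) (W' & HW' & Wx' & D').
    exists (fun z => W z /\ W' z); repeat split; auto; [apply open_inter; auto|].
    intros z [Uz|Vz] [Wz Wz']; [eapply D | eapply D']; eauto.
  - intros y Ky; destruct (HS y x) as (U & V & HU & HV & Uy & Vx & D).
    + intro E; subst; auto.
    + exists U; repeat split; auto; exists V; repeat split; auto; intros z Uz Vz; apply (D z); auto.
  - exists W; repeat split; auto; intros y Wy Ky; exact (D y (C y Ky) Wy).
Qed.

(** [compact_ideal] is used twice: on the complement of [U], to separate it from one point of [A],
    and then on [A]. The closed [C] between [V] and [U] is the form that Urysohn's construction
    iterates. *)
Lemma compact_Hausdorff_normal (S : Space) (A U : S -> Prop) :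
  compact S -> Hausdorff S -> closed S A -> is_open U -> (forall x, A x -> U x) ->
  exists V C, is_open V /\ closed S C /\ (forall x, A x -> V x) /\
    (forall x, V x -> C x) /\ (forall x, C x -> U x).
Proof.
  intros HC HH HA HU AU.
  assert (reg : forall x, A x -> exists V W, is_open V /\ is_open W /\ V x /\
            (forall z, V z -> ~ W z) /\ forall z, ~ U z -> W z).
  { intros x Ax.
    assert (HK : compact (sub S (fun z => ~ U z))).
    { apply closed_compact; auto; apply (open_ext U); auto; intro; tauto. }
    destruct (compact_ideal S _ (fun W => exists V, is_open V /\ V x /\ forall z, V z -> ~ W z) HK)
      as (W & HW & (V & HV & Vx & D) & C).
    - exists (fun _ => True); repeat split; [apply open_full | tauto].
    - intros W W' (V & HV & Vx & D) (V' & HV' & Vx' & D').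
      exists (fun z => V z /\ V' z); repeat split; auto; [apply open_inter; auto|].
      intros z [Vz V'z] [Wz|W'z]; [eapply D | eapply D']; eauto.
    - intros y Uy; destruct (HH y x) as (W & V & HW & HV & Wy & Vx & D).
      + intro E; subst; auto.
      + exists W; repeat split; auto; exists V; repeat split; auto; intros z Vz Wz; apply (D z); auto.
    - exists V, W; repeat split; auto. }
  destruct (compact_ideal S A (fun V => exists W, is_open W /\ (forall z, ~ U z -> W z) /\
     forall z, V z -> ~ W z) (closed_compact S A HC HA)) as (V & HV & (W & HW & UW & D) & C).
  - exists (fun _ => True); repeat split; auto; apply open_full.
  - intros V V' (W & HW & UW & D) (W' & HW' & UW' & D').
    exists (fun z => W z /\ W' z); repeat split; auto; [apply open_inter; auto|].
    intros z [Vz|Vz] [Wz Wz']; [eapply D | eapply D']; eauto.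
  - intros x Ax; destruct (reg x Ax) as (V & W & HV & HW & Vx & D & UW).
    exists V; repeat split; auto; exists W; auto.
  - exists V, (fun z => ~ W z); repeat split; auto.
    + apply (open_ext W); auto; intro; tauto.
    + intros x Nx; apply NNPP; auto.
Qed.

(** * Real-valued continuous functions *)

Lemma continuous_R_iff {S : Space} (f : S -> R_space) :
  continuous f <-> forall x eps, eps > 0 ->
    exists U, is_open U /\ U x /\ forall y, U y -> Rabs (f y - f x) < eps.
Proof.
  split.
  - intros Hf x eps He.
    exists (fun y => Rabs (f y - f x) < eps); repeat split; auto.
    + apply (Hf (fun r : R_space => Rabs (r - f x) < eps)).
      intros r Hr; exists (eps - Rabs (r - f x)); split; [lra|].
      intros y Hy. replace (y - f x) with ((y - r) + (r - f x)) by ring.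
      eapply Rle_lt_trans; [apply Rabs_triang | lra].
    + rewrite Rminus_diag, Rabs_R0; lra.
  - intros H V HV; apply open_local; intros x Vx.
    destruct (HV _ Vx) as (eps & He & B).
    destruct (H x eps He) as (U & HU & Ux & C); exists U; auto.
Qed.

Lemma continuous_comp {S T W : Space} (f : S -> T) (g : T -> W) :
  continuous f -> continuous g -> continuous (fun x => g (f x)).
Proof. intros Hf Hg V HV; exact (Hf _ (Hg V HV)). Qed.

Lemma continuous_proj1 (S : Space) (A : S -> Prop) :
  @continuous (sub S A) S (@proj1_sig S A).
Proof. intros V HV; exists V; split; [auto | tauto]. Qed.

Lemma continuous_const {S : Space} (c : R) : @continuous S R_space (fun _ => c).
Proof. intros V _; apply open_const. Qed.

Lemma continuous_plus {S : Space} (f g : S -> R_space) :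
  continuous f -> continuous g -> @continuous S R_space (fun x => f x + g x).
Proof.
  intros Hf Hg; apply continuous_R_iff; intros x eps He.
  destruct (proj1 (continuous_R_iff f) Hf x (eps / 2)) as (U & HU & Ux & CU); [lra|].
  destruct (proj1 (continuous_R_iff g) Hg x (eps / 2)) as (V & HV & Vx & CV); [lra|].
  exists (fun x => U x /\ V x); repeat split; auto; [apply open_inter; auto|].
  intros y [Uy Vy]; specialize (CU y Uy); specialize (CV y Vy).
  replace (f y + g y - (f x + g x)) with ((f y - f x) + (g y - g x)) by ring.
  eapply Rle_lt_trans; [apply Rabs_triang | lra].
Qed.

Lemma continuous_comp_pt {S : Space} (f : S -> R_space) (g : R -> R) :
  continuous f -> (forall x, continuity_pt g (f x)) -> @continuous S R_space (fun x => g (f x)).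
Proof.
  intros Hf Hg; apply continuous_R_iff; intros x eps He.
  destruct (Hg x eps He) as (d & Hd & B).
  destruct (proj1 (continuous_R_iff f) Hf x d Hd) as (U & HU & Ux & C).
  exists U; repeat split; auto; intros y Uy.
  destruct (Req_dec (f y) (f x)) as [E|N].
  - rewrite E, Rminus_diag, Rabs_R0; lra.
  - apply (B (f y)); split; [split; [exact I | auto] | apply C; auto].
Qed.

Lemma continuous_opp {S : Space} (f : S -> R_space) :
  continuous f -> @continuous S R_space (fun x => - f x).
Proof. intro Hf; apply (continuous_comp_pt f Ropp Hf); intro x; reg. Qed.

Lemma continuous_mult {S : Space} (f g : S -> R_space) :
  continuous f -> continuous g -> @continuous S R_space (fun x => f x * g x).
Proof.
  intros Hf Hg.
  assert (sq : forall h : S -> R_space, continuous h -> @continuous S R_space (fun x => h x * h x / 4)).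
  { intros h Hh; apply (continuous_comp_pt h (fun r => r * r / 4) Hh); intro x; reg. }
  assert (H := continuous_plus _ _ (sq _ (continuous_plus _ _ Hf Hg))
     (continuous_opp _ (sq _ (continuous_plus _ _ Hf (continuous_opp _ Hg))))).
  replace (fun x => f x * g x) with
    (fun x => (f x + g x) * (f x + g x) / 4 + - ((f x + - g x) * (f x + - g x) / 4)); auto.
  apply functional_extensionality; intro x; field.
Qed.

Lemma continuous_abs {S : Space} (f : S -> R_space) :
  continuous f -> @continuous S R_space (fun x => Rabs (f x)).
Proof. intro Hf; apply (continuous_comp_pt f Rabs Hf); intro x; apply Rcontinuity_abs. Qed.

Lemma continuous_min {S : Space} (f : S -> R_space) (c : R) :
  continuous f -> @continuous S R_space (fun x => Rmin (f x) c).
Proof.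
  intro Hf.
  replace (fun x => Rmin (f x) c) with (fun x => (f x + c + - Rabs (f x + - c)) * (1 / 2)).
  - apply continuous_mult; [|apply continuous_const].
    apply continuous_plus; [apply continuous_plus; auto; apply continuous_const|].
    apply continuous_opp, continuous_abs, continuous_plus; auto; apply continuous_const.
  - apply functional_extensionality; intro x; unfold Rmin, Rabs.
    destruct Rcase_abs, Rle_dec; lra.
Qed.

Lemma continuous_max {S : Space} (f : S -> R_space) (c : R) :
  continuous f -> @continuous S R_space (fun x => Rmax (f x) c).
Proof.
  intro Hf.
  replace (fun x => Rmax (f x) c) with (fun x => - Rmin (- f x) (- c)).
  - apply continuous_opp, continuous_min, continuous_opp, Hf.
  - apply functional_extensionality; intro x; unfold Rmin, Rmax.
    do 2 destruct Rle_dec; lra.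
Qed.

Lemma continuous_inv1 {S : Space} (f : S -> R_space) :
  continuous f -> @continuous S R_space (fun x => / (1 + Rabs (f x))).
Proof.
  intro Hf; apply (continuous_comp_pt (fun x => Rabs (f x)) (fun r => / (1 + r)));
    [apply continuous_abs, Hf|].
  intro x; apply continuity_pt_inv; [reg|].
  assert (H := Rabs_pos (f x)); lra.
Qed.

Lemma open_lt {S : Space} (f : S -> R_space) (c : R) : continuous f -> is_open (fun x => f x < c).
Proof.
  intro Hf; apply (Hf (fun r : R_space => r < c)).
  intros r Hr; exists (c - r); split; [lra|]; intros y Hy; apply Rabs_def2 in Hy; lra.
Qed.

Lemma open_gt {S : Space} (f : S -> R_space) (c : R) : continuous f -> is_open (fun x => c < f x).
Proof.
  intro Hf; apply (Hf (fun r : R_space => c < r)).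
  intros r Hr; exists (r - c); split; [lra|]; intros y Hy; apply Rabs_def2 in Hy; lra.
Qed.

(** * Urysohn's lemma *)

Section Urysohn.
Context (S : Space) (HC : compact S) (HH : Hausdorff S).

Definition well_inside (A B : S -> Prop) : Prop :=
  is_open A /\ is_open B /\
  exists C, closed S C /\ (forall x, A x -> C x) /\ (forall x, C x -> B x).

(** The hypothesis stands under the existential so that choice yields a total operation, which a
    fixpoint can call without carrying proofs. *)
Lemma well_inside_interpolate (A B : S -> Prop) :
  exists M, well_inside A B -> well_inside A M /\ well_inside M B.
Proof.
  destruct (classic (well_inside A B)) as [(HA & HB & C & HCl & AC & CB)|N];
    [|exists A; tauto].
  destruct (compact_Hausdorff_normal S C B HC HH HCl HB CB) as (M & C' & HM & HC' & H1 & H2 & H3).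
  exists M; intros _; split; (split; [|split]); auto; [exists C | exists C']; auto.
Qed.

Definition interpolant (A B : S -> Prop) : S -> Prop :=
  proj1_sig (constructive_indefinite_description _ (well_inside_interpolate A B)).

(* [dyadic_chain U0 U1 n k] is the open set attached to the dyadic number [k / 2^n]. *)
Fixpoint dyadic_chain (U0 U1 : S -> Prop) (n k : nat) : S -> Prop :=
  match n with
  | O => match k with O => U0 | 1%nat => U1 | _ => fun _ => True end
  | Datatypes.S m =>
      if Nat.even k then dyadic_chain U0 U1 m (Nat.div2 k)
      else interpolant (dyadic_chain U0 U1 m (Nat.div2 k))
                       (dyadic_chain U0 U1 m (Datatypes.S (Nat.div2 k)))
  end.

Lemma dyadic_chain_double U0 U1 n k :
  dyadic_chain U0 U1 (Datatypes.S n) (2 * k) = dyadic_chain U0 U1 n k.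
Proof.
  cbn [dyadic_chain]. rewrite Nat.even_even, Nat.div2_double; reflexivity.
Qed.

Lemma dyadic_chain_refine U0 U1 d n k :
  dyadic_chain U0 U1 (d + n) (k * 2 ^ d) = dyadic_chain U0 U1 n k.
Proof.
  induction d as [|d IH]; [rewrite Nat.mul_1_r; reflexivity|].
  replace (k * 2 ^ Datatypes.S d)%nat with (2 * (k * 2 ^ d))%nat by (simpl; lia).
  rewrite Nat.add_succ_l, dyadic_chain_double; exact IH.
Qed.

Lemma dyadic_chain_step U0 U1 : well_inside U0 U1 ->
  forall n k, well_inside (dyadic_chain U0 U1 n k) (dyadic_chain U0 U1 n (Datatypes.S k)).
Proof.
  intros H n; induction n as [|n IH]; intro k.
  - destruct H as (H0 & H1 & C & HCl & H2 & H3).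
    destruct k as [|[|k]]; simpl; (split; [|split]); auto; try apply open_full.
    + exists C; auto.
    + exists (fun _ => True); repeat split; auto; exact (open_const (~ True)).
    + exists (fun _ => True); repeat split; auto; exact (open_const (~ True)).
  - assert (G : forall A B, well_inside A B ->
              well_inside A (interpolant A B) /\ well_inside (interpolant A B) B).
    { intros A B; exact (proj2_sig (constructive_indefinite_description _
                                      (well_inside_interpolate A B))). }
    destruct (Nat.Even_or_Odd k) as [[m ->]|[m ->]].
    + rewrite dyadic_chain_double; cbn [dyadic_chain].
      replace (Datatypes.S (2 * m)) with (2 * m + 1)%nat by lia.
      rewrite Nat.even_odd, Nat.add_1_r, Nat.div2_succ_double; apply G, IH.
    + replace (Datatypes.S (2 * m + 1)) with (2 * Datatypes.S m)%nat by lia.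
      rewrite dyadic_chain_double; cbn [dyadic_chain].
      rewrite Nat.even_odd, Nat.add_1_r, Nat.div2_succ_double; apply G, IH.
Qed.

Lemma dyadic_chain_mono U0 U1 : well_inside U0 U1 ->
  forall n k l, (k <= l)%nat -> forall x, dyadic_chain U0 U1 n k x -> dyadic_chain U0 U1 n l x.
Proof.
  intros H n k l Hkl; induction Hkl as [|l _ IH]; auto; intros x Hx.
  destruct (dyadic_chain_step _ _ H n l) as (_ & _ & C & _ & H1 & H2); auto.
Qed.

Lemma pow2_pos n : 0 < 2 ^ n.
Proof. apply pow_lt; lra. Qed.

(** Both sets are read at a common level, where the chain is monotone in the index. *)
Lemma dyadic_chain_lt U0 U1 : well_inside U0 U1 ->
  forall n k m l x, dyadic_chain U0 U1 n k x -> ~ dyadic_chain U0 U1 m l x ->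
  INR l / 2 ^ m < INR k / 2 ^ n.
Proof.
  intros H n k m l x Hk Hl.
  assert (Hlt : (l * 2 ^ n < k * 2 ^ m)%nat).
  { apply Nat.nle_gt; intro Hle; apply Hl.
    rewrite <- (dyadic_chain_refine U0 U1 n m l).
    apply (dyadic_chain_mono _ _ H _ _ _ Hle).
    rewrite Nat.add_comm, dyadic_chain_refine; exact Hk. }
  apply lt_INR in Hlt; rewrite !mult_INR, !pow_INR in Hlt.
  change (INR 2) with 2 in Hlt.
  assert (Pm := pow2_pos m); assert (Pn := pow2_pos n).
  apply (Rmult_lt_reg_r (2 ^ n * 2 ^ m)); [nra|].
  replace (INR l / 2 ^ m * (2 ^ n * 2 ^ m)) with (INR l * 2 ^ n) by (field; lra).
  replace (INR k / 2 ^ n * (2 ^ n * 2 ^ m)) with (INR k * 2 ^ m) by (field; lra).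
  exact Hlt.
Qed.

Lemma dyadic_between (a b : R) : 0 <= a -> a < b ->
  exists n k, a < INR k / 2 ^ n /\ INR (Datatypes.S k) / 2 ^ n < b.
Proof.
  intros Ha Hab.
  (* Once [2 ^ n * (b - a) >= 3], the index [k = up (a * 2 ^ n)] satisfies
     [k + 1 <= a * 2 ^ n + 2 < b * 2 ^ n], which leaves room for two consecutive dyadic numbers. *)
  destruct (Pow_x_infinity 2 ltac:(rewrite Rabs_right; lra) (3 / (b - a))) as (n & Hn).
  specialize (Hn n (Nat.le_refl n)).
  assert (P := pow2_pos n).
  rewrite Rabs_right in Hn by lra.
  assert (Hn' : 3 <= 2 ^ n * (b - a)).
  { apply Rge_le in Hn; apply (Rmult_le_compat_r (b - a)) in Hn; [|lra].
    replace (3 / (b - a) * (b - a)) with 3 in Hn by (field; lra); exact Hn. }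
  destruct (archimed (a * 2 ^ n)) as [A1 A2].
  assert (Hup : (0 <= up (a * 2 ^ n))%Z).
  { apply le_IZR; nra. }
  exists n, (Z.to_nat (up (a * 2 ^ n))).
  rewrite S_INR, INR_IZR_INZ, Z2Nat.id by exact Hup.
  split.
  - apply (Rmult_lt_reg_r (2 ^ n)); auto; unfold Rdiv.
    rewrite Rmult_assoc, Rinv_l, Rmult_1_r; lra.
  - apply (Rmult_lt_reg_r (2 ^ n)); auto; unfold Rdiv.
    rewrite Rmult_assoc, Rinv_l, Rmult_1_r; nra.
Qed.

(** The value at a point is the infimum of the dyadic numbers whose set contains it, obtained as the
    supremum of their lower bounds. Near a point, a set of the chain bounds [f] from above; the
    complement of a closed set between two consecutive sets bounds it from below. *)
Lemma dyadic_chain_function U0 U1 : well_inside U0 U1 ->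
  exists f : S -> R_space, continuous f /\ (forall x, U0 x -> f x <= 0) /\
    (forall x, 0 <= f x) /\ forall x, ~ U1 x -> 1 <= f x.
Proof.
  intro H; set (G := dyadic_chain U0 U1).
  assert (Hinf : forall x, exists r, (forall n k, G n k x -> r <= INR k / 2 ^ n) /\
             forall s, (forall n k, G n k x -> s <= INR k / 2 ^ n) -> s <= r).
  { intro x.
    destruct (completeness (fun s => forall n k, G n k x -> s <= INR k / 2 ^ n)) as (r & Hr1 & Hr2).
    (* At level 0 the index 2 carries the whole space, so every lower bound is at most 2. *)
    - exists 2; intros s Hs. specialize (Hs O 2%nat I); simpl in Hs; lra.
    - exists 0; intros n k _.
      apply Rmult_le_pos; [apply pos_INR | left; apply Rinv_0_lt_compat, pow2_pos].
    - exists r; split; [|exact Hr1].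
      intros n k Hk; apply Hr2; intros s Hs; apply (Hs n k Hk). }
  assert (Hfun : exists f : S -> R_space, forall x,
    (forall n k, G n k x -> f x <= INR k / 2 ^ n) /\
    forall s, (forall n k, G n k x -> s <= INR k / 2 ^ n) -> s <= f x).
  { exists (fun x => proj1_sig (constructive_indefinite_description _ (Hinf x))).
    intro x; exact (proj2_sig (constructive_indefinite_description _ (Hinf x))). }
  destruct Hfun as [f Hf]; exists f.
  assert (f0 : forall x, 0 <= f x).
  { intro x; apply (proj2 (Hf x)); intros n k _.
    apply Rmult_le_pos; [apply pos_INR | left; apply Rinv_0_lt_compat, pow2_pos]. }
  split; [|split; [|split]]; auto.
  - apply continuous_R_iff; intros x eps He.
    assert (Hup : exists U, is_open U /\ U x /\ forall y, U y -> f y < f x + eps).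
    { destruct (dyadic_between (f x) (f x + eps)) as (n & k & H1 & H2); auto; [lra|].
      assert (Gx : exists m l, G m l x /\ INR l / 2 ^ m < INR k / 2 ^ n).
      { apply NNPP; intro N.
        assert (INR k / 2 ^ n <= f x); [|lra].
        apply (proj2 (Hf x)); intros m l Hl.
        apply Rnot_lt_le; intro Hlt; apply N; exists m, l; auto. }
      destruct Gx as (m & l & Gl & Hlt).
      destruct (dyadic_chain_step _ _ H m l) as (HO & _).
      exists (G m l); repeat split; auto; intros y Gy.
      assert (B := proj1 (Hf y) m l Gy).
      rewrite S_INR in H2; assert (P := Rinv_0_lt_compat _ (pow2_pos n)); unfold Rdiv in *; nra. }
    assert (Hlow : exists U, is_open U /\ U x /\ forall y, U y -> f x - eps < f y).
    { destruct (Rlt_le_dec (f x - eps) 0) as [Hneg|Hpos].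
      - exists (fun _ => True); repeat split; [apply open_full|].
        intros y _; specialize (f0 y); lra.
      - destruct (dyadic_between (f x - eps) (f x)) as (n & k & H1 & H2); auto; [lra|].
        destruct (dyadic_chain_step _ _ H n k) as (_ & _ & C & HCl & GC & CG).
        exists (fun y => ~ C y); repeat split; auto.
        + intro Cx; assert (B := proj1 (Hf x) _ _ (CG x Cx)); lra.
        + intros y Ny; apply Rlt_le_trans with (INR k / 2 ^ n); auto.
          apply (proj2 (Hf y)); intros m l Gy; left.
          apply (dyadic_chain_lt U0 U1 H m l n k y); auto. }
    destruct Hup as (U & HU & Ux & BU); destruct Hlow as (V & HV & Vx & BV).
    exists (fun y => U y /\ V y); repeat split; auto; [apply open_inter; auto|].
    intros y [Uy Vy]; specialize (BU y Uy); specialize (BV y Vy); apply Rabs_def1; lra.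
  - intros x Hx; assert (B := proj1 (Hf x) O O Hx); simpl in B; rewrite Rdiv_0_l in B; exact B.
  - intros x Hx; apply (proj2 (Hf x)); intros n k Gk; left.
    replace 1 with (INR 1 / 2 ^ 0) by (simpl; field).
    apply (dyadic_chain_lt U0 U1 H n k O 1 x); auto.
Qed.

Lemma compact_Hausdorff_completely_regular : completely_regular S.
Proof.
  intros F x HF Nx.
  destruct (compact_Hausdorff_normal S (fun z => z = x) (fun z => ~ F z) HC HH)
    as (V & C & HV & HCl & H1 & H2 & H3).
  - apply closed_point; auto.
  - exact HF.
  - intros z ->; exact Nx.
  - destruct (dyadic_chain_function V (fun z => ~ F z)) as (f & Hf & f0 & fpos & f1).
    + split; [|split]; auto; exists C; auto.
    + exists (fun z => Rmin (f z) 1); split; [apply continuous_min, Hf | split].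
      * specialize (f0 x (H1 x eq_refl)); specialize (fpos x).
        unfold Rmin; destruct Rle_dec; lra.
      * intros y Fy; specialize (f1 y (fun N => N Fy)); apply Rmin_right; auto.
Qed.

End Urysohn.

(** * Extending functions from a dense subspace *)

Definition extend {X T : Type} (j : X -> T) (f : X -> R) (c : R) (t : T) : R :=
  match excluded_middle_informative (exists x, j x = t) with
  | left h => f (proj1_sig (constructive_indefinite_description _ h))
  | right _ => c
  end.

Lemma extend_in {X T : Type} (j : X -> T) f c x :
  (forall x y, j x = j y -> x = y) -> extend j f c (j x) = f x.
Proof.
  intro inj; unfold extend; destruct excluded_middle_informative as [h|n].
  - f_equal; apply inj, (proj2_sig (constructive_indefinite_description _ h)).
  - destruct n; exists x; auto.
Qed.

Lemma extend_out {X T : Type} (j : X -> T) f c t :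
  ~ (exists x, j x = t) -> extend j f c t = c.
Proof.
  intro N; unfold extend; destruct excluded_middle_informative; tauto.
Qed.

Lemma extend_continuous {X T : Space} (j : X -> T) (f : X -> R_space) c :
  embedding j -> closed T (fun t => ~ exists x, j x = t) -> continuous f ->
  (forall t eps, ~ (exists x, j x = t) -> eps > 0 ->
     exists V, is_open V /\ V t /\ forall x, V (j x) -> Rabs (f x - c) < eps) ->
  @continuous T R_space (extend j f c).
Proof.
  intros (_ & inj & emb) cl Hf Hc; apply continuous_R_iff; intros t eps He.
  destruct (classic (exists x, j x = t)) as [[x <-]|N].
  - destruct (proj1 (continuous_R_iff f) Hf x eps He) as (U & HU & Ux & C).
    destruct (emb U HU) as (V & HV & E).
    exists (fun t => V t /\ ~ ~ exists x, j x = t); repeat split.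
    + apply open_inter; auto.
    + apply E; auto.
    + intro N; apply N; exists x; auto.
    + intros y [Vy Jy]; apply NNPP in Jy; destruct Jy as [z <-].
      rewrite !extend_in; auto; apply C, E, Vy.
  - destruct (Hc t eps N He) as (V & HV & Vt & C).
    exists V; repeat split; auto; intros y Vy; rewrite (extend_out j f c t N).
    destruct (classic (exists x, j x = y)) as [[x <-]|M].
    + rewrite extend_in; auto.
    + rewrite extend_out, Rminus_diag, Rabs_R0; auto; lra.
Qed.

Lemma dense_eq {X T : Space} (j : X -> T) (A : T -> Prop) (u v : sub T A -> R_space) :
  dense_map j -> continuous u -> continuous v ->
  (forall x h, u (exist _ (j x) h) = v (exist _ (j x) h)) ->
  (forall x, A (j x)) -> forall q, u q = v q.
Proof.
  intros dj Hu Hv E HA q; apply NNPP; intro N.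
  assert (Hw : @continuous (sub T A) R_space (fun z => Rabs (u z + - v z))).
  { apply continuous_abs, continuous_plus; auto; apply continuous_opp, Hv. }
  destruct (open_gt _ 0 Hw) as (U & HU & EU).
  destruct (dj U HU) as [x Ux].
  - exists (proj1_sig q); apply EU, Rabs_pos_lt; lra.
  - specialize (proj2 (EU (exist _ (j x) (HA x))) Ux) as B; simpl in B.
    rewrite E, Rplus_opp_r, Rabs_R0 in B; lra.
Qed.

Definition corestrict {X T : Space} (j : X -> T) (A : T -> Prop) (hA : forall x, A (j x)) :
  X -> sub T A := fun x => exist A (j x) (hA x).

Lemma embedding_corestrict {X T : Space} (j : X -> T) (A : T -> Prop) hA :
  embedding j -> embedding (corestrict j A hA).
Proof.
  intros (Hj & inj & emb); split; [|split].
  - intros V (U & HU & E).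
    apply (open_ext (fun x => U (j x))); [apply Hj, HU|]; intro x; rewrite E; simpl; tauto.
  - intros x y Exy; apply inj; exact (f_equal (@proj1_sig _ _) Exy).
  - intros U HU; destruct (emb U HU) as (V & HV & E).
    exists (fun z => V (proj1_sig z)); split; [exists V; split; [auto | tauto] | exact E].
Qed.

(** * Zero sets missing [X], and the Hewitt realcompactification *)

Section Hewitt.
Context (X K : Space) (e : X -> K) (HK : stone_cech X K e).

(** For [p = e x] the subspace in question is the image of [e] itself, so the extension is [f]
    transported along the embedding. *)
Lemma hewitt_image x : in_hewitt X K e (e x).
Proof.
  destruct HK as (_ & _ & He & _ & _); intros f Hf.
  set (A := fun q => q = e x \/ exists x0, e x0 = q).
  assert (hA : forall x, A (e x)) by (intro z; right; exists z; auto).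
  assert (Himg : forall t : sub K A, exists z, corestrict e A hA z = t).
  { intros [q [->|[z <-]]]; [exists x | exists z];
      unfold corestrict; f_equal; apply proof_irrelevance. }
  exists (extend (corestrict e A hA) f 0); split.
  - apply extend_continuous; auto; [apply embedding_corestrict, He| |].
    + apply (open_ext (fun _ => True)); [apply open_full | intro t; specialize (Himg t); tauto].
    + intros t eps N; destruct (N (Himg t)).
  - intros z h; rewrite (proof_irrelevance _ h (hA z)).
    apply (extend_in (corestrict e A hA)), (embedding_corestrict e A hA He).
Qed.

Lemma inv1_extension (f : X -> R_space) : continuous f ->
  exists G : K -> R_space, continuous G /\ forall x, G (e x) = / (1 + Rabs (f x)).
Proof.
  intro Hf; destruct HK as (_ & _ & _ & _ & ext).
  destruct (ext (fun x => / (1 + Rabs (f x))) (continuous_inv1 f Hf)) as (G & HG & E); [|exists G; auto].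
  exists 1; intro x; assert (P := Rabs_pos (f x)).
  rewrite Rabs_right; [|left; apply Rinv_0_lt_compat; lra].
  rewrite <- Rinv_1; apply Rinv_le_contravar; lra.
Qed.

(** By density [G = 1 / (1 + |g|)] on all of [A], and the right side never vanishes. *)
Lemma extension_inv1_neq0 (f : X -> R_space) (G : K -> R_space) (A : K -> Prop)
    (g : sub K A -> R_space) (q : sub K A) :
  continuous G -> (forall x, G (e x) = / (1 + Rabs (f x))) -> (forall x, A (e x)) ->
  continuous g -> (forall x h, g (exist _ (e x) h) = f x) -> G (proj1_sig q) <> 0.
Proof.
  intros HG EG HA Hg Eg; destruct HK as (_ & _ & _ & de & _).
  assert (E : (fun z : sub K A => G (proj1_sig z)) q = (fun z => / (1 + Rabs (g z))) q).
  { apply (dense_eq e A (fun z => G (proj1_sig z)) (fun z => / (1 + Rabs (g z)))); auto.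
    - apply (@continuous_comp (sub K A) K R_space (@proj1_sig _ A) G); auto; apply continuous_proj1.
    - apply continuous_inv1, Hg.
    - intros x h; simpl; rewrite EG, Eg; auto. }
  simpl in E; rewrite E; apply Rinv_neq_0_compat; assert (P := Rabs_pos (g q)); lra.
Qed.

(** If [G q] is nonzero, then [|f|] stays below [2 / |G q|] near [q]; the truncation of [f] at that
    height extends to [K] and supplies a value at [q]. If this happens for every [f], then [q] lies
    in the realcompactification. *)
Lemma not_hewitt_zero q : ~ in_hewitt X K e q ->
  exists (f : X -> R_space) (G : K -> R_space), continuous f /\ continuous G /\
    (forall x, G (e x) = / (1 + Rabs (f x))) /\ G q = 0.
Proof.
  intro Nq; assert (NX : ~ exists x, e x = q).
  { intros [x <-]; apply Nq, hewitt_image. }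
  apply NNPP; intro Nall; apply Nq; intros f Hf.
  destruct (inv1_extension f Hf) as (G & HG & EG).
  assert (Gq : 0 < Rabs (G q)).
  { apply Rabs_pos_lt; intro E; apply Nall; exists f, G; auto. }
  set (c := Rabs (G q) / 2); assert (Hc : 0 < c) by (unfold c; lra).
  destruct HK as (_ & HH & He & de & ext).
  (* near [q] the function [f] agrees with its truncation at height [/ c] *)
  set (fM := fun x => Rmax (Rmin (f x) (/ c)) (- / c)).
  assert (P := Rinv_0_lt_compat _ Hc).
  destruct (ext fM) as (H & HH' & EH).
  { apply continuous_max, continuous_min, Hf. }
  { exists (/ c); intro x; unfold fM, Rmax, Rmin.
    repeat destruct Rle_dec; apply Rabs_le; lra. }
  assert (near : forall x, c < Rabs (G (e x)) -> H (e x) = f x).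
  { intros x B; rewrite EH; rewrite EG in B; assert (Pf := Rabs_pos (f x)).
    rewrite Rabs_right in B by (left; apply Rinv_0_lt_compat; lra).
    assert (B' : Rabs (f x) < / c).
    { apply Rinv_lt_contravar in B.
      - rewrite Rinv_inv in B; lra.
      - apply Rmult_lt_0_compat; auto; apply Rinv_0_lt_compat; lra. }
    apply Rabs_def2 in B'; unfold fM, Rmin, Rmax; repeat destruct Rle_dec; lra. }
  set (A := fun p => p = q \/ exists x, e x = p).
  assert (hA : forall x, A (e x)) by (intro z; right; exists z; auto).
  assert (Hj := embedding_corestrict e A hA He).
  exists (extend (corestrict e A hA) f (H q)); split.
  - assert (img : forall t : sub K A, ~ (exists x, corestrict e A hA x = t) <-> proj1_sig t = q).
    { intros [t [->|[z Ez]]]; simpl; split; auto.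
      - intros _ [x Ex]; apply NX; exists x; exact (f_equal (@proj1_sig _ _) Ex).
      - intro N; destruct N; exists z; subst t; unfold corestrict; f_equal; apply proof_irrelevance.
      - intros -> ; destruct NX; exists z; auto. }
    apply extend_continuous; auto.
    + exists (fun t => t <> q); split; [apply closed_point, HH|].
      intro z; rewrite img; tauto.
    + intros t eps Nt Heps; apply img in Nt.
      destruct (proj1 (continuous_R_iff H) HH' q eps Heps) as (U & HU & Uq & C).
      exists (fun z => U (proj1_sig z) /\ c < Rabs (G (proj1_sig z))); split; [|split].
      * exists (fun z => U z /\ c < Rabs (G z)); split; [|tauto].
        apply open_inter; auto; apply (open_gt (fun z => Rabs (G z))), continuous_abs, HG.
      * rewrite Nt; split; auto; unfold c; lra.
      * simpl; intros x [Ux Bx]; rewrite <- (near x Bx); auto.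
  - intros x h; rewrite (proof_irrelevance _ h (hA x)).
    apply (extend_in (corestrict e A hA)), Hj.
Qed.

(** Without a zero, compactness of [K] gives a positive lower bound [c] for [|G|], hence
    [|f| < 1 / c] on [X]. *)
Lemma unbounded_extension_zero (f : X -> R_space) (G : K -> R_space) :
  continuous G -> (forall x, G (e x) = / (1 + Rabs (f x))) ->
  ~ (exists M, forall x, Rabs (f x) <= M) -> exists q, G q = 0.
Proof.
  intros HG EG Nb; destruct HK as (HC & _); apply NNPP; intro N; apply Nb.
  assert (HCT : compact (sub K (fun _ => True))).
  { apply closed_compact; auto; apply (open_ext (fun _ => False)); [apply open_empty | tauto]. }
  destruct (compact_ideal K _ (fun U => exists c, 0 < c /\ forall z, U z -> c < Rabs (G z)) HCT)
    as (U & HU & (c & Hc & B) & C).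
  - exists 1; split; [lra | tauto].
  - intros U V (c & Hc & B) (c' & Hc' & B'); exists (Rmin c c'); split; [apply Rmin_pos; auto|].
    intros z [Uz|Vz]; eapply Rle_lt_trans; [apply Rmin_l| |apply Rmin_r|]; auto.
  - intros x _; assert (Gx : 0 < Rabs (G x)).
    { apply Rabs_pos_lt; intro E; apply N; exists x; auto. }
    exists (fun z => Rabs (G x) / 2 < Rabs (G z)); repeat split.
    + apply (open_gt (fun z => Rabs (G z))), continuous_abs, HG.
    + lra.
    + exists (Rabs (G x) / 2); split; [lra | auto].
  - exists (/ c); intro x; specialize (B (e x) (C _ I)); rewrite EG in B.
    assert (Pf := Rabs_pos (f x)).
    rewrite Rabs_right in B by (left; apply Rinv_0_lt_compat; lra).
    apply Rinv_lt_contravar in B.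
    + rewrite Rinv_inv in B; lra.
    + apply Rmult_lt_0_compat; auto; apply Rinv_0_lt_compat; lra.
Qed.

Lemma not_pseudocompact_not_hewitt : ~ pseudocompact X -> exists q, ~ in_hewitt X K e q.
Proof.
  intro N; apply NNPP; intro Nall; apply N; intros f Hf; apply NNPP; intro Nb.
  destruct (inv1_extension f Hf) as (G & HG & EG).
  destruct (unbounded_extension_zero f G HG EG Nb) as (q & Gq).
  apply Nall; exists q; intro Hq; destruct (Hq f Hf) as (g & Hg & Eg).
  apply (extension_inv1_neq0 f G _ g (exist _ q (or_introl eq_refl)) HG EG); auto.
  intro x; right; exists x; auto.
Qed.

(** Let [V] have its trace inside a compact [C]. For a point [y] of [V] outside the image, some [W]
    around [y] misses the image of [C], although density puts a point of [X] in both [V] and [W]. *)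
Lemma image_open : locally_compact X -> is_open (fun z => exists x, e x = z).
Proof.
  intro LC; destruct HK as (_ & HH & (Ce & inj & emb) & de & _).
  apply open_local; intros z [x <-].
  destruct (LC x) as (U & HU & Ux & C & HC & UC).
  destruct (emb U HU) as (V & HV & E).
  exists V; repeat split; [auto | apply E; auto|].
  intros y Vy; apply NNPP; intro Ny.
  destruct (compact_ideal X C (fun O => exists W, is_open W /\ W y /\ forall x, O x -> ~ W (e x)) HC)
    as (O & HO & (W & HW & Wy & D) & CO).
  - exists (fun _ => True); repeat split; [apply open_full | tauto].
  - intros O O' (W & HW & Wy & D) (W' & HW' & Wy' & D').
    exists (fun z => W z /\ W' z); repeat split; auto; [apply open_inter; auto|].
    intros z [Oz|Oz] [Wz Wz']; [eapply D | eapply D']; eauto.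
  - intros z Cz; destruct (HH (e z) y) as (A & B & HA & HB & Az & By & D).
    + intro Ez; apply Ny; exists z; auto.
    + exists (fun z => A (e z)); repeat split; [apply Ce, HA | auto|].
      exists B; repeat split; auto; intros t At Bt; apply (D (e t)); auto.
  - destruct (de (fun z => V z /\ W z)) as [t [Vt Wt]].
    + apply open_inter; auto.
    + exists y; auto.
    + apply (D t); auto; apply CO, UC, E, Vt.
Qed.

End Hewitt.

(** * The partial equivalence relation of an extension *)

Section Extension.
Context (X K : Space) (e : X -> K) (HK : stone_cech X K e).

(* [lim E p y]: the canonical map from beta X to beta E sends [p] to the point [y] of [E].
   Since beta E is not at hand, this is phrased with neighbourhood traces on [X]. *)
Definition lim (E : Ext X) (p : K) (y : ext_sp E) : Prop :=
  forall (W : K -> Prop) (V : ext_sp E -> Prop),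
    is_open W -> W p -> is_open V -> V y -> exists x, W (e x) /\ V (ext_map E x).

(** On the diagonal, [ext_per E p p] says that [p] is sent into [E] itself, not to a point of beta E
    outside it; this is the domain of the relation. Off the diagonal it records identifications. *)
Definition ext_per (E : Ext X) (p q : K) : Prop :=
  (~ exists x, e x = p) /\ (~ exists x, e x = q) /\ exists y, lim E p y /\ lim E q y.

Lemma not_lim_separated E p y : ~ lim E p y ->
  exists W V, is_open W /\ W p /\ is_open V /\ V y /\ forall x, W (e x) -> ~ V (ext_map E x).
Proof.
  intro N; apply NNPP; intro M; apply N; intros W V HW Wp HV Vy; apply NNPP; intro L.
  apply M; exists W, V; repeat split; auto; intros x Wx Vx; apply L; exists x; auto.
Qed.

(* This is where the Stone-Cech property enters: a cluster point is a limit. *)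
Lemma lim_converges E p y V : lim E p y -> is_open V -> V y ->
  exists W, is_open W /\ W p /\ forall x, W (e x) -> V (ext_map E x).
Proof.
  intros L HV Vy; destruct HK as (_ & _ & _ & _ & ext).
  destruct (ext_tychonoff X E) as [_ CR].
  destruct (CR (fun z => ~ V z) y) as (g & Hg & g0 & g1).
  - apply (open_ext V); auto; intro; tauto.
  - tauto.
  - set (f := (fun z => Rmin (Rabs (g z)) 1) : ext_sp E -> R_space).
    assert (Hf : continuous f) by apply continuous_min, continuous_abs, Hg.
    destruct (ext (fun x => f (ext_map E x))) as (G & HG & EG).
    + apply (continuous_comp (ext_map E) f); auto; apply (ext_embedding X E).
    + exists 1; intro x; unfold f; assert (P := Rabs_pos (g (ext_map E x))).
      unfold Rmin; destruct Rle_dec; rewrite Rabs_right; lra.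
    + destruct (Rlt_le_dec (G p) 1) as [Hlt|Hge].
      * exists (fun z => G z < 1); repeat split; [apply open_lt, HG | auto|].
        intros x Gx; apply NNPP; intro N; rewrite EG in Gx; unfold f in Gx.
        rewrite (g1 _ N), Rabs_R1, Rmin_left in Gx; lra.
      * destruct (L (fun z => 1 / 2 < G z) (fun z => f z < 1 / 2)) as (x & A & B).
        -- apply open_gt, HG.
        -- lra.
        -- apply open_lt, Hf.
        -- unfold f; rewrite g0, Rabs_R0, Rmin_left; lra.
        -- rewrite EG in A; lra.
Qed.

Lemma lim_unique E p y y' : lim E p y -> lim E p y' -> y = y'.
Proof.
  intros L L'; apply NNPP; intro N.
  destruct (ext_tychonoff X E) as [HH _].
  destruct (HH y y' N) as (V & V' & HV & HV' & Vy & Vy' & D).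
  destruct (lim_converges E p y V L HV Vy) as (W & HW & Wp & C).
  destruct (L' W V' HW Wp HV' Vy') as (x & Wx & V'x); apply (D (ext_map E x)); auto.
Qed.

(** [K] and [E] induce the same topology on [X], so a neighbourhood of [e x] in [K] has the trace of
    some neighbourhood of [ext_map E x]. Hence no point of beta X outside [X] is sent into [X]. *)
Lemma lim_image E p x : lim E p (ext_map E x) <-> p = e x.
Proof.
  split.
  - intro L; apply NNPP; intro N; destruct HK as (_ & HH & (Ce & _) & _).
    destruct (HH p (e x) N) as (W & W' & HW & HW' & Wp & Wx & D).
    destruct (ext_embedding X E) as (_ & _ & emb).
    destruct (emb (fun z => W' (e z)) (Ce W' HW')) as (V & HV & EV).
    destruct (L W V HW Wp HV (proj1 (EV x) Wx)) as (z & Wz & Vz).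
    apply (D (e z)); split; auto; apply EV, Vz.
  - intros -> W V _ Wx _ Vx; exists x; auto.
Qed.

Lemma lim_remainder E p y : (~ exists x, e x = p) -> lim E p y -> remainder E y.
Proof. intros N L [x <-]; apply N; exists x; symmetry; apply (lim_image E), L. Qed.

(** The partial map behaves like a closed one: each point off [W] is separated from [y], and
    compactness of the complement of [W] lets one neighbourhood of [y] serve for all of it. *)
Lemma lim_tube E y W : is_open W -> (forall p, lim E p y -> W p) ->
  exists V, is_open V /\ V y /\ forall x, V (ext_map E x) -> W (e x).
Proof.
  intros HW LW; destruct HK as (HC & _).
  assert (HCW : compact (sub K (fun z => ~ W z))).
  { apply closed_compact; auto; apply (open_ext W); auto; intro; tauto. }
  destruct (compact_ideal K _ (fun U => exists V, is_open V /\ V y /\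
              forall x, U (e x) -> ~ V (ext_map E x)) HCW) as (U & HU & (V & HV & Vy & D) & C).
  - exists (fun _ => True); repeat split; [apply open_full | tauto].
  - intros U U' (V & HV & Vy & D) (V' & HV' & Vy' & D').
    exists (fun z => V z /\ V' z); repeat split; auto; [apply open_inter; auto|].
    intros z [Uz|Uz] [Vz Vz']; [eapply D | eapply D']; eauto.
  - intros p Np; destruct (not_lim_separated E p y) as (U & V & HU & Up & HV & Vy & D); auto.
    exists U; repeat split; auto; exists V; auto.
  - exists V; repeat split; auto; intros x Vx; apply NNPP; intro N; exact (D x (C _ N) Vx).
Qed.

Lemma lim_surjective E y : exists p, lim E p y.
Proof.
  apply NNPP; intro N.
  destruct (lim_tube E y (fun _ => False) open_empty) as (V & HV & Vy & D).
  - intros p L; apply N; exists p; auto.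
  - destruct (ext_dense X E V HV) as [x Vx]; [exists y; auto | exact (D x Vx)].
Qed.

(** This is what a compact remainder contributes: pointwise separation from [p] becomes separation
    of [p] from the whole remainder. *)
Lemma remainder_separated E p : compact (sub (ext_sp E) (remainder E)) ->
  (forall y, remainder E y -> ~ lim E p y) ->
  exists W V, is_open W /\ W p /\ is_open V /\ (forall y, remainder E y -> V y) /\
    forall x, W (e x) -> ~ V (ext_map E x).
Proof.
  intros HC N.
  destruct (compact_ideal _ _ (fun V => exists W, is_open W /\ W p /\
              forall x, W (e x) -> ~ V (ext_map E x)) HC) as (V & HV & (W & HW & Wp & D) & C).
  - exists (fun _ => True); repeat split; [apply open_full | tauto].
  - intros U U' (V & HV & Vy & D) (V' & HV' & Vy' & D').
    exists (fun z => V z /\ V' z); repeat split; auto; [apply open_inter; auto|].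
    intros z [Vz Vz'] [Uz|Uz]; [eapply D | eapply D']; eauto.
  - intros y Ry; destruct (not_lim_separated E p y) as (W & V & HW & Wp & HV & Vy & D); auto.
    exists V; repeat split; auto; exists W; auto.
  - exists W, V; repeat split; auto.
Qed.

Lemma ext_per_sym E p q : ext_per E p q -> ext_per E q p.
Proof. intros (A & B & y & L & M); repeat split; auto; exists y; auto. Qed.

Lemma ext_per_left E p q : ext_per E p q -> ext_per E p p.
Proof. intros (A & B & y & L & M); repeat split; auto; exists y; auto. Qed.

(** For the converse, the map sends [y] to the common limit in [E1] of all points of its fibre: the
    diagonal pairs of the hypothesis give existence of a limit, the other pairs show that the whole
    fibre shares it. *)
Lemma ext_le_per E1 E2 :
  ext_le E1 E2 <-> forall p q, ext_per E2 p q -> ext_per E1 p q.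
Proof.
  split.
  - intros (h & Hh & Eh) p q (A & B & y & L & M); repeat split; auto; exists (h y).
    assert (T : forall p, lim E2 p y -> lim E1 p (h y)).
    { intros r Lr W V HW Wr HV Vy.
      destruct (Lr W (fun z => V (h z)) HW Wr (Hh V HV) Vy) as (x & Wx & Vx).
      exists x; rewrite <- Eh; auto. }
    split; apply T; auto.
  - intro H.
    assert (tot : forall y2, exists y1, forall p, lim E2 p y2 -> lim E1 p y1).
    { intro y2; destruct (classic (exists x, ext_map E2 x = y2)) as [[x <-]|Ny].
      - exists (ext_map E1 x); intros p L; apply lim_image; apply lim_image in L; exact L.
      - assert (NX : forall p, lim E2 p y2 -> ~ exists x, e x = p).
        { intros p L [x <-]; apply Ny; exists x.
          apply (lim_unique E2 (e x)); auto; apply lim_image; auto. }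
        destruct (lim_surjective E2 y2) as [p L].
        destruct (H p p) as (_ & _ & y1 & L1 & _); [repeat split; eauto|].
        exists y1; intros q Lq.
        destruct (H p q) as (_ & _ & y1' & L1' & Lq'); [repeat split; eauto|].
        rewrite (lim_unique E1 p y1 y1'); auto. }
    assert (fn : exists h : ext_sp E2 -> ext_sp E1, forall y p, lim E2 p y -> lim E1 p (h y)).
    { exists (fun y => proj1_sig (constructive_indefinite_description _ (tot y))).
      intro y; exact (proj2_sig (constructive_indefinite_description _ (tot y))). }
    destruct fn as [h Hh]; exists h.
    assert (hX : forall x, h (ext_map E2 x) = ext_map E1 x).
    { intro x; apply (lim_unique E1 (e x)); [apply Hh|]; apply lim_image; auto. }
    split; auto.
    (* [h] maps traces on [X] correctly; regularity of [E1] turns this into continuity. *)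
    assert (trace : forall y V, is_open V -> V (h y) ->
              exists V', is_open V' /\ V' y /\ forall x, V' (ext_map E2 x) -> V (ext_map E1 x)).
    { intros y V HV Vy.
      destruct (lim_tube E2 y (fun z => exists W, (is_open W /\
                  forall x, W (e x) -> V (ext_map E1 x)) /\ W z)) as (V' & HV' & V'y & C).
      - apply open_union; tauto.
      - intros p L; destruct (lim_converges E1 p (h y) V) as (W & HW & Wp & C); auto.
        exists W; auto.
      - exists V'; repeat split; auto.
        intros x Vx; destruct (C x Vx) as (W & (_ & HW) & Wx); auto. }
    intros V HV; apply open_local; intros y Vy.
    destruct (ext_tychonoff X E1) as [_ CR].
    destruct (CR (fun z => ~ V z) (h y)) as (g & Hg & g0 & g1).
    + apply (open_ext V); auto; intro; tauto.
    + tauto.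
    + destruct (trace y (fun z => g z < 1 / 2)) as (V' & HV' & V'y & C).
      * apply open_lt, Hg.
      * lra.
      * exists V'; repeat split; auto; intros z V'z; apply NNPP; intro Nz.
        destruct (trace z (fun z => 1 / 2 < g z)) as (V2 & HV2 & V2z & C2).
        -- apply open_gt, Hg.
        -- rewrite (g1 _ Nz); lra.
        -- destruct (ext_dense X E2 (fun z => V' z /\ V2 z)) as [x [Vx V2x]].
           ++ apply open_inter; auto.
           ++ exists z; auto.
           ++ specialize (C x Vx); specialize (C2 x V2x); simpl in *; lra.
Qed.

Lemma ext_per_domain_closed E p : in_U E -> (~ exists x, e x = p) -> ~ ext_per E p p ->
  exists W, is_open W /\ W p /\ forall q, W q -> ~ ext_per E q q.
Proof.
  intros [_ HC] NX Np.
  destruct (remainder_separated E p HC) as (W & V & HW & Wp & HV & RV & D).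
  - intros y _ L; apply Np; repeat split; eauto.
  - exists W; repeat split; auto; intros q Wq (NXq & _ & y & L & _).
    destruct (L W V HW Wq HV) as (x & Wx & Vx).
    + apply RV, (lim_remainder E q); auto.
    + exact (D x Wx Vx).
Qed.

(* If the fibre over [q] missed [E], an unbounded continuous function on [X] concentrated
   near [q] would extend by [0] over the remainder. *)
Lemma ext_per_not_hewitt E q : in_U E -> ~ in_hewitt X K e q -> ext_per E q q.
Proof.
  intros [HP HC] Nq.
  assert (NX : ~ exists x, e x = q).
  { intros [x <-]; apply Nq, (hewitt_image X K e HK). }
  apply NNPP; intro Np.
  destruct (remainder_separated E q HC) as (W & V & HW & Wq & HV & RV & D).
  { intros y _ L; apply Np; repeat split; eauto. }
  destruct (not_hewitt_zero X K e HK q Nq) as (f & G & Hf & HG & EG & Gq).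
  assert (HK' := HK); destruct HK' as (HcK & HH & (Ce & _) & de & _).
  destruct (compact_Hausdorff_completely_regular K HcK HH (fun z => ~ W z) q)
    as (chi & Hchi & chi0 & chi1).
  - apply (open_ext W); auto; intro; tauto.
  - tauto.
  (* [k] is 0 at the points outside [W], hence near the remainder, and exceeds half of [1 + |f|]
     where [chi < 1 / 2]. *)
  - set (k := fun x => (1 + - chi (e x)) * (1 + Rabs (f x))).
    assert (Hk : @continuous X R_space k).
    { apply continuous_mult; apply continuous_plus; try apply continuous_const.
      - apply continuous_opp, (continuous_comp e chi); auto.
      - apply continuous_abs, Hf. }
    destruct (HP (extend (ext_map E) k 0)) as [M HM].
    + apply extend_continuous; auto.
      * apply (ext_embedding X E).
      * apply (compact_closed (ext_sp E) (remainder E)); auto; apply (ext_tychonoff X E).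
      * intros t eps Nt He; exists V; repeat split; auto.
        intros x Vx; assert (kx : k x = 0).
        { unfold k; rewrite chi1 by (intro Wx; exact (D x Wx Vx)); ring. }
        rewrite kx, Rminus_diag, Rabs_R0; lra.
    (* [G < 1 / (2 * N)] means [1 + |f| > 2 * N]; the factor above 1/2 coming from [chi] leaves
       [k > N > M]. *)
    + set (N := Rabs M + 1); assert (PN := Rabs_pos M).
      assert (HN : 0 < / (2 * N)) by (apply Rinv_0_lt_compat; unfold N; lra).
      destruct (de (fun z => chi z < 1 / 2 /\ G z < / (2 * N))) as (x & chix & Gx).
      * apply open_inter; apply open_lt; auto.
      * exists q; rewrite chi0, Gq; split; lra.
      * specialize (HM (ext_map E x)).
        rewrite extend_in in HM by apply (ext_embedding X E).
        rewrite EG in Gx; assert (Pf := Rabs_pos (f x)).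
        apply Rinv_lt_contravar in Gx.
        2: { apply Rmult_lt_0_compat; auto; apply Rinv_0_lt_compat; lra. }
        rewrite !Rinv_inv in Gx.
        assert (B : N < k x) by (unfold k; nra).
        assert (B1 := Rle_abs (k x)); assert (B2 := Rle_abs M); unfold N in B; lra.
Qed.

(** The domain is closed relative to beta X minus [X], and a point of the closure cannot lie in [X],
    which is open and consists of points of the realcompactification. *)
Lemma ext_per_closure_hewitt E q : locally_compact X -> in_U E ->
  closure K (fun z => ~ in_hewitt X K e z) q -> ext_per E q q.
Proof.
  intros LC HE Cq; apply NNPP; intro Nq.
  assert (NX : ~ exists x, e x = q).
  { intro Hx; destruct (Cq _ (image_open X K e HK LC) Hx) as (y & [x <-] & Ny).
    apply Ny, (hewitt_image X K e HK). }
  destruct (ext_per_domain_closed E q HE NX Nq) as (W & HW & Wq & D).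
  destruct (Cq W HW Wq) as (z & Wz & Nz); exact (D z Wz (ext_per_not_hewitt E z HE Nz)).
Qed.

End Extension.

(** * Extensions obtained by gluing two points *)

(* The points of [A] with the topology induced by the open sets of [S] that do not separate
   [a] from [b]: the quotient identifying [a] and [b], when [A] omits [b]. *)
Definition glue_open (S : Space) (a b : S) (A : S -> Prop) (V : {x : S | A x} -> Prop) : Prop :=
  exists U, is_open U /\ (U a <-> U b) /\ forall z, V z <-> U (proj1_sig z).

Lemma glue_open_full S a b A : glue_open S a b A (fun _ => True).
Proof. exists (fun _ => True); repeat split; auto; apply open_full. Qed.

Lemma glue_open_inter S a b A : forall U V, glue_open S a b A U -> glue_open S a b A V ->
  glue_open S a b A (fun x => U x /\ V x).
Proof.
  intros U V (U' & HU & SU & EU) (V' & HV & SV & EV).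
  exists (fun x => U' x /\ V' x); split; [apply open_inter; auto | split; [tauto|]].
  intro z; rewrite EU, EV; tauto.
Qed.

Lemma glue_open_union S a b A : forall F, (forall U, F U -> glue_open S a b A U) ->
  glue_open S a b A (fun x => exists U, F U /\ U x).
Proof.
  intros F HF.
  exists (fun x => exists W, (is_open W /\ (W a <-> W b) /\
            exists V, F V /\ forall z, V z <-> W (proj1_sig z)) /\ W x).
  split; [|split].
  - apply open_union; tauto.
  - split; intros (W & H & Wx); exists W; (split; [exact H | apply H; exact Wx]).
  - intro z; split.
    + intros (V & FV & Vz); destruct (HF V FV) as (W & HW & SW & EW).
      exists W; split; [split; [auto | split; [auto | exists V; auto]] | apply EW, Vz].
    + intros (W & (_ & _ & V & FV & EV) & Wz); exists V; split; auto; apply EV, Wz.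
Qed.

Definition glue (S : Space) (a b : S) (A : S -> Prop) : Space := {|
  pt := {x : S | A x}; is_open := glue_open S a b A; open_full := glue_open_full S a b A;
  open_inter := glue_open_inter S a b A; open_union := glue_open_union S a b A |}.

Lemma continuous_glue (S : Space) (a b : S) A (f : S -> R_space) :
  continuous f -> f a = f b ->
  @continuous (glue S a b A) R_space (fun z => f (proj1_sig z)).
Proof.
  intros Hf E V HV; exists (fun z => V (f z)); split; [apply Hf, HV | split; [rewrite E|]; tauto].
Qed.

Section Glue.
Context (X K : Space) (e : X -> K) (HK : stone_cech X K e).
Context (D : K -> Prop) (a b : K).
Context (HD : closed K D) (DX : forall x, ~ D (e x)).
Context (QD : forall q, closure K (fun z => ~ in_hewitt X K e z) q -> D q).
Context (Da : D a) (Db : D b).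

(** The class of [a] and [b] is represented by [a], so [b] is left out. The condition becomes
    vacuous when [a = b], so the same construction also yields extensions without any gluing. *)
Definition glue_carrier (z : K) : Prop := ((exists x, e x = z) \/ D z) /\ (z = b -> a = b).

Definition glue_space : Space := glue K a b glue_carrier.

Lemma glue_carrier_image x : glue_carrier (e x).
Proof. split; [left; exists x; auto | intro E; destruct (DX x); rewrite E; auto]. Qed.

Definition glue_map (x : X) : glue_space := exist _ (e x) (glue_carrier_image x).

Lemma glue_saturate (U : K -> Prop) : is_open U ->
  @is_open glue_space (fun z => U (proj1_sig z) /\ proj1_sig z <> a /\ proj1_sig z <> b).
Proof.
  intro HU; destruct HK as (_ & HH & _).
  exists (fun z => U z /\ z <> a /\ z <> b); split; [|split; [|tauto]].
  - apply open_inter; auto; apply open_inter; apply closed_point; auto.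
  - split; intros (_ & A & B); tauto.
Qed.

Lemma glue_map_embedding : embedding glue_map.
Proof.
  destruct HK as (_ & HH & (Ce & inj & emb) & _); split; [|split].
  - intros V (U & HU & _ & E); apply (open_ext (fun x => U (e x))); [apply Ce, HU|].
    intro x; rewrite E; simpl; tauto.
  - intros x y E; apply inj; exact (f_equal (@proj1_sig _ _) E).
  - intros U HU; destruct (emb U HU) as (V & HV & E).
    exists (fun z => V (proj1_sig z) /\ proj1_sig z <> a /\ proj1_sig z <> b).
    split; [apply glue_saturate, HV|]; intro x; rewrite E; simpl; split; [|tauto].
    intro Vx; repeat split; auto; intro Ex; apply (DX x); rewrite Ex; auto.
Qed.

Lemma glue_map_dense : dense_map glue_map.
Proof.
  destruct HK as (_ & _ & _ & de & _); intros V (U & HU & _ & E) [z Vz].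
  destruct (de U HU) as [x Ux]; [exists (proj1_sig z); apply E, Vz|].
  exists x; apply E, Ux.
Qed.

(** A separating function on [K] must take equal values at [a] and [b]. The product of three
    functions, one for each of [x], [a] and [b], does: it is 0 at both when they lie in [U], and 1
    at both otherwise. *)
Lemma glue_completely_regular : completely_regular glue_space.
Proof.
  intros F x (U & HU & SU & E) Nx.
  assert (Ux : U (proj1_sig x)) by (apply E, Nx).
  destruct HK as (HC & HH & _).
  assert (CR := compact_Hausdorff_completely_regular K HC HH).
  assert (HF : closed K (fun z => ~ U z)) by (apply (open_ext U); auto; intro; tauto).
  assert (sep : forall p, exists f : K -> R_space, continuous f /\ (U p -> f p = 0) /\
            forall z, ~ U z -> f z = 1).
  { intro p; destruct (classic (U p)) as [Up|Np].
    - destruct (CR (fun z => ~ U z) p HF) as (f & Hf & f0 & f1); [tauto|].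
      exists f; auto.
    - exists (fun _ => 1); split; [apply continuous_const | tauto]. }
  destruct (sep (proj1_sig x)) as (f & Hf & f0 & f1).
  destruct (sep a) as (g & Hg & g0 & g1); destruct (sep b) as (h & Hh & h0 & h1).
  exists (fun z => f (proj1_sig z) * (g (proj1_sig z) * h (proj1_sig z))).
  split; [|split].
  - apply (continuous_glue K a b glue_carrier (fun z => f z * (g z * h z))).
    + apply continuous_mult; auto; apply continuous_mult; auto.
    + destruct (classic (U a)) as [Ua|Na].
      * rewrite (g0 Ua), (h0 (proj1 SU Ua)), Rmult_0_l, !Rmult_0_r; auto.
      * assert (Nb : ~ U b) by tauto; rewrite !f1, !g1, !h1; auto.
  - rewrite f0; auto; apply Rmult_0_l.
  - intros y Fy; assert (Ny : ~ U (proj1_sig y)) by (intro Uy; apply E in Uy; auto).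
    rewrite f1, g1, h1, !Rmult_1_l; auto.
Qed.

Lemma glue_Hausdorff : Hausdorff glue_space.
Proof.
  intros x y N; destruct HK as (_ & HH & _).
  assert (Nxy : proj1_sig x <> proj1_sig y).
  { intro E; apply N; destruct x as [x hx], y as [y hy]; simpl in E; subst; f_equal;
      apply proof_irrelevance. }
  destruct (glue_completely_regular (fun z => z = y) x) as (f & Hf & f0 & f1); auto.
  - destruct (proj2_sig y) as [_ yb].
    (* The complement of [y] must not separate [a] from [b], so [b] is removed too when [y] is the
       glued point. *)
    exists (fun z => z <> proj1_sig y /\ (proj1_sig y = a -> z <> b)); split; [|split].
    + apply open_inter; [apply closed_point; auto|].
      apply (open_ext (fun z => proj1_sig y <> a \/ z <> b)); [|intro; tauto].
      apply open_union2; [apply open_const | apply closed_point; auto].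
    + split.
      * intros [A B]; split; [|intro Ea; symmetry in Ea; tauto].
        intro Eb; symmetry in Eb; apply A; rewrite Eb; auto.
      * intros [A B]; split; [intro Ea; symmetry in Ea; apply (B Ea); auto|].
        intros Ea Eb; apply A; rewrite <- Eb; auto.
    + intro z; simpl; split.
      * intro Nz; assert (Nzy : proj1_sig z <> proj1_sig y).
        { intro E; apply Nz; destruct z as [z hz], y as [y hy]; simpl in E; subst; f_equal;
            apply proof_irrelevance. }
        split; auto; intros Ea Eb; apply Nzy.
        rewrite Eb, Ea; destruct (proj2_sig z) as [_ zb]; symmetry; apply zb, Eb.
      * intros [A _] E; apply A; rewrite E; auto.
  - specialize (f1 y eq_refl).
    exists (fun z => f z < 1 / 2), (fun z => 1 / 2 < f z); repeat split.
    + apply open_lt, Hf.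
    + apply open_gt, Hf.
    + rewrite f0; lra.
    + rewrite f1; lra.
    + intros z [A B]; lra.
Qed.

Definition glue_ext : Ext X := {|
  ext_sp := glue_space; ext_map := glue_map; ext_embedding := glue_map_embedding;
  ext_dense := glue_map_dense;
  ext_tychonoff := conj glue_Hausdorff glue_completely_regular |}.

Lemma glue_lim p (z : glue_space) :
  lim X K e glue_ext p z <-> p = proj1_sig z \/ (proj1_sig z = a /\ p = b).
Proof.
  destruct HK as (_ & HH & _ & de & _); split.
  - intro L; apply NNPP; intro N.
    assert (sep : forall q, p <> q -> exists W V, is_open W /\ is_open V /\ W p /\ V q /\
              forall t, ~ (W t /\ V t)) by (intros q Nq; apply HH, Nq).
    destruct (sep (proj1_sig z)) as (W & V & HW & HV & Wp & Vz & DWV); [tauto|].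
    destruct (classic (proj1_sig z = a)) as [Ea|Na].
    (* An open set around the glued point has to contain [b] as well, so neighbourhoods of both
       points are joined. *)
    + destruct (sep b) as (W' & V' & HW' & HV' & Wp' & Vb & DWV'); [tauto|].
      destruct (L (fun t => W t /\ W' t) (fun t => V (proj1_sig t) \/ V' (proj1_sig t)))
        as (x & [Wx Wx'] & [Vx|Vx]).
      * apply open_inter; auto.
      * auto.
      * exists (fun t => V t \/ V' t); split; [apply open_union2; auto | split; [|tauto]].
        rewrite Ea in Vz; tauto.
      * auto.
      * apply (DWV (e x)); auto.
      * apply (DWV' (e x)); auto.
    + destruct (L W (fun t => V (proj1_sig t) /\ proj1_sig t <> a /\ proj1_sig t <> b))
        as (x & Wx & Vx & _); auto.
      * apply glue_saturate, HV.
      * repeat split; auto; intro Eb; apply Na; rewrite Eb; symmetry.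
        destruct (proj2_sig z) as [_ zb]; auto.
      * apply (DWV (e x)); auto.
  - intros H W V HW Wp (U & HU & SU & E) Vz.
    assert (Up : U p).
    { apply E in Vz; destruct H as [->|[Ea ->]]; auto; apply SU; rewrite <- Ea; auto. }
    destruct (de (fun t => W t /\ U t)) as (x & Wx & Ux).
    + apply open_inter; auto.
    + exists p; auto.
    + exists x; split; auto; apply E, Ux.
Qed.

Lemma glue_remainder (z : glue_space) : remainder glue_ext z <-> D (proj1_sig z).
Proof.
  split.
  - intro N; destruct (proj2_sig z) as [[[x Ex]|Dz] _]; auto; destruct N; exists x.
    destruct z as [z hz]; simpl in *; subst; unfold glue_map; f_equal; apply proof_irrelevance.
  - intros Dz [x Ex]; apply (DX x); rewrite <- Ex in Dz; exact Dz.
Qed.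

Lemma glue_target p : D p -> exists z : glue_space,
  D (proj1_sig z) /\ (p = proj1_sig z \/ (proj1_sig z = a /\ p = b)).
Proof.
  intro Dp; destruct (classic (p = b)) as [->|N].
  - assert (Ca : glue_carrier a) by (split; auto).
    exists (exist _ a Ca); simpl; auto.
  - assert (Cp : glue_carrier p) by (split; [auto | tauto]).
    exists (exist _ p Cp); simpl; auto.
Qed.

Lemma glue_per p q : ext_per X K e glue_ext p q <->
  D p /\ D q /\ (p = q \/ (p = a /\ q = b) \/ (p = b /\ q = a)).
Proof.
  split.
  - intros (Np & Nq & z & Lp & Lq).
    assert (Dz : D (proj1_sig z)).
    { apply glue_remainder, (lim_remainder X K e HK glue_ext p); auto. }
    apply glue_lim in Lp; apply glue_lim in Lq.
    destruct Lp as [->|[Ea ->]], Lq as [->|[Ea' ->]]; tauto.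
  - intros (Dp & Dq & H).
    assert (NX : forall r, D r -> ~ exists x, e x = r).
    { intros r Dr [x <-]; exact (DX x Dr). }
    split; [auto | split; auto].
    destruct H as [<-|H].
    + destruct (glue_target p Dp) as (z & _ & Hz); exists z; split; apply glue_lim, Hz.
    + destruct (glue_target b Db) as (z & _ & Hz); exists z.
      assert (Hz' : a = proj1_sig z).
      { destruct Hz as [Eb|[Ea _]]; auto; rewrite <- Eb.
        destruct (proj2_sig z) as [_ zb]; auto. }
      destruct H as [[-> ->]|[-> ->]]; split; apply glue_lim; auto.
Qed.

Lemma glue_compact_remainder : compact (sub (ext_sp glue_ext) (remainder glue_ext)).
Proof.
  destruct HK as (HC & _).
  apply (compact_image (sub K D) (sub (ext_sp glue_ext) (remainder glue_ext))
    (fun p y => let z := proj1_sig (proj1_sig y) in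
       proj1_sig p = z \/ (z = a /\ proj1_sig p = b))); simpl.
  - apply closed_compact; auto.
  - intros [z Rz]; simpl; assert (Dz := proj1 (glue_remainder z) Rz).
    exists (exist _ _ Dz); simpl; auto.
  - intros [p Dp]; simpl; destruct (glue_target p Dp) as (z & Dz & Hz).
    exists (exist _ z (proj2 (glue_remainder z) Dz)); simpl; auto.
  - intros [p Dp] [z Rz] V H (V' & (U & HU & SU & EU) & EV) Vz; simpl in *.
    assert (Up : U p).
    { apply EV, EU in Vz; destruct H as [->|[Ea ->]]; auto; apply SU; rewrite <- Ea; auto. }
    exists (fun t => U (proj1_sig t)); split; [exists U; split; [auto | tauto] | split; auto].
    intros [p' Dp'] [z' Rz'] Up' H'; simpl in *; apply EV; simpl; apply EU.
    destruct H' as [<-|[-> ->]]; auto; apply SU, Up'.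
Qed.

(* An unbounded function on [X] has a zero of the extension of [1/(1+|f|)] outside the Hewitt
   realcompactification, hence in [D], where a finite value of [f] rules it out. *)
Lemma glue_pseudocompact : pseudocompact glue_space.
Proof.
  intros f Hf.
  assert (Hfj : @continuous X R_space (fun x => f (glue_map x))).
  { apply (continuous_comp glue_map f); auto; apply glue_map_embedding. }
  apply NNPP; intro Nb.
  assert (NbX : ~ exists M, forall x, Rabs (f (glue_map x)) <= M).
  { intros [M HM]; apply Nb; exists M; intro z; apply Rnot_lt_le; intro Hlt.
    destruct (glue_map_dense (fun t => M < Rabs (f t))) as [x Hx].
    - apply (open_gt (fun t => Rabs (f t))), continuous_abs, Hf.
    - exists z; auto.
    - specialize (HM x); lra. }
  destruct (inv1_extension X K e HK _ Hfj) as (G & HG & EG).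
  destruct (unbounded_extension_zero X K e HK _ G HG EG NbX) as (q & Gq).
  assert (Dq : D q).
  { apply QD; intros U HU Uq; exists q; split; auto; intro Hq.
    destruct (Hq _ Hfj) as (g & Hg & Eg).
    apply (extension_inv1_neq0 X K e HK _ G _ g (exist _ q (or_introl eq_refl)) HG EG); auto.
    intro x; right; exists x; auto. }
  destruct (glue_target q Dq) as (z & _ & Hz); apply glue_lim in Hz.
  (* Near [z] one has [|f| < M], while [G < 1 / (1 + M)] near [q] forces [|f| > M]; since [q] is
     sent to [z], both occur at one point of [X]. *)
  set (M := Rabs (f z) + 1); assert (PM := Rabs_pos (f z)).
  destruct (Hz (fun t => G t < / (1 + M)) (fun t => Rabs (f t) < M)) as (x & Gx & Bx).
  - apply open_lt, HG.
  - rewrite Gq; apply Rinv_0_lt_compat; unfold M; lra.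
  - apply (open_lt (fun t => Rabs (f t))), continuous_abs, Hf.
  - unfold M; lra.
  - rewrite EG in Gx; assert (P := Rabs_pos (f (glue_map x))); simpl in Bx.
    apply Rinv_lt_contravar in Gx.
    + rewrite !Rinv_inv in Gx; lra.
    + apply Rmult_lt_0_compat; apply Rinv_0_lt_compat; unfold M; lra.
Qed.

Lemma glue_in_U : in_U glue_ext.
Proof. split; [apply glue_pseudocompact | apply glue_compact_remainder]. Qed.

End Glue.

(** * Recovering points and closed sets from the order *)

Definition greatest {X : Space} (E : Ext X) : Prop :=
  forall E', in_U E' -> ext_le E' E.

(* [A] is the middle of a three-element chain that makes up everything above some [T]. *)
Definition point_type {X : Space} (A : Ext X) : Prop :=
  ~ greatest A /\ exists T, in_U T /\ ext_le T A /\ ~ ext_le A T /\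
    forall E, in_U E -> ext_le T E ->
      greatest E \/ (ext_le E A /\ ext_le A E) \/ ext_le E T.

Section Points.
Context (X K : Space) (e : X -> K) (HK : stone_cech X K e) (LC : locally_compact X).

Local Notation Q := (closure K (fun z => ~ in_hewitt X K e z)).
Local Notation per := (ext_per X K e).
Local Notation target := (target_set X K e).

Definition point_ext (E : Ext X) (p : K) : Prop :=
  in_U E /\ forall u v, per E u v <-> u = v /\ (Q u \/ u = p).

Lemma closure_not_hewitt_image x : ~ Q (e x).
Proof.
  intro Cx; destruct (Cx _ (image_open X K e HK LC)) as (y & [z <-] & Ny); [exists x; auto|].
  apply Ny, (hewitt_image X K e HK).
Qed.

Lemma per_realized (D : K -> Prop) a b :
  closed K D -> (forall x, ~ D (e x)) -> (forall q, Q q -> D q) -> D a -> D b ->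
  exists E, in_U E /\ forall p q, per E p q <->
    D p /\ D q /\ (p = q \/ (p = a /\ q = b) \/ (p = b /\ q = a)).
Proof.
  intros HD DX QD Da Db; exists (glue_ext X K e HK D a b DX Da Db); split.
  - apply glue_in_U; auto.
  - intros p q; apply glue_per.
Qed.

Lemma per_realized_point p a b : target p -> Q a \/ a = p -> Q b \/ b = p ->
  exists E, in_U E /\ forall u v, per E u v <->
    (Q u \/ u = p) /\ (Q v \/ v = p) /\ (u = v \/ (u = a /\ v = b) \/ (u = b /\ v = a)).
Proof.
  intros [NX NQ] Ha Hb; apply (per_realized (fun z => Q z \/ z = p)); auto.
  - apply closed_union2; [apply closed_closure | apply closed_point, HK].
  - intros x [Qx|Ex]; [exact (closure_not_hewitt_image x Qx) | apply NX; exists x; auto].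
Qed.

Lemma per_realized_pair a b : Q a -> Q b ->
  exists E, in_U E /\ forall u v, per E u v <->
    Q u /\ Q v /\ (u = v \/ (u = a /\ v = b) \/ (u = b /\ v = a)).
Proof.
  intros Ha Hb; apply (per_realized Q); auto.
  - apply closed_closure.
  - apply closure_not_hewitt_image.
Qed.

Lemma point_ext_exists p : target p -> exists E, point_ext E p.
Proof.
  intro Hp; destruct (per_realized_point p p p Hp) as (E & HE & P); auto.
  exists E; split; auto; intros u v; rewrite P; split.
  - intros (A & B & [->|[[-> ->]|[-> ->]]]); auto.
  - intros [-> A]; auto.
Qed.

Lemma per_refl_Q E q : in_U E -> Q q -> per E q q.
Proof. intros HE; apply ext_per_closure_hewitt; auto. Qed.

(** The point [q0] lets equality on [Q] be realized, as the gluing of [q0] with itself; a greatest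
    member must lie above that extension. *)
Lemma greatest_per E q0 : Q q0 ->
  greatest E <-> forall u v, per E u v -> Q u /\ u = v.
Proof.
  intro H0; split.
  - intros G u v P; destruct (per_realized_pair q0 q0 H0 H0) as (E0 & HE0 & P0).
    apply (proj1 (ext_le_per X K e HK E0 E) (G E0 HE0)), P0 in P.
    destruct P as (Qu & _ & [->|[[-> ->]|[-> ->]]]); auto.
  - intros H E' HE'; apply (ext_le_per X K e HK); intros u v P.
    destruct (H u v P) as [Qu <-]; apply per_refl_Q; auto.
Qed.

Lemma per_outside E u v : per E u v -> ~ Q u -> target u.
Proof. intros (NX & _) NQ; split; auto. Qed.

(** [E] is a probe that turns membership of [p] in a domain into an order relation: beyond equality
    on [Q], which every relation here contains, its relation has only the pair of [p] with
    itself. *)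
Lemma point_ext_le E p E' : point_ext E p -> in_U E' -> (ext_le E' E <-> per E' p p).
Proof.
  intros [HE P] HE'; rewrite (ext_le_per X K e HK); split.
  - intro H; apply H, P; auto.
  - intros Hp u v Huv; apply P in Huv; destruct Huv as [<- [Qu| ->]]; auto.
    apply per_refl_Q; auto.
Qed.

(** The witness [T] glues [p] to [q0]. A relation inside it that omits [p] from its domain is
    equality on [Q]; otherwise only the presence of the pair [p], [q0] remains to be decided. *)
Lemma point_ext_point_type E p q0 : Q q0 -> target p -> point_ext E p -> point_type E.
Proof.
  intros H0 Hp [HE P]; assert (Hp' := Hp); destruct Hp' as [_ NQ]; split.
  - intro G; assert (Ppp : per E p p) by (apply P; auto).
    apply (proj1 (greatest_per E q0 H0) G) in Ppp; destruct Ppp; auto.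
  - destruct (per_realized_point p p q0 Hp) as (T & HT & PT); auto.
    exists T; split; [auto | split; [|split]].
    + apply (ext_le_per X K e HK); intros u v Huv; apply P in Huv; apply PT.
      destruct Huv as [<- A]; auto.
    + intro L; assert (Pq : per E p q0).
      { apply (proj1 (ext_le_per X K e HK E T) L), PT; split; [auto | split; auto]. }
      apply P in Pq; destruct Pq as [-> _]; auto.
    + intros S HS L; assert (LT := proj1 (ext_le_per X K e HK T S) L).
      destruct (classic (per S p p)) as [Sp|Np].
      * right; destruct (classic (per S p q0)) as [Spq|Npq].
        -- right; apply (ext_le_per X K e HK); intros u v Huv; apply PT in Huv.
           destruct Huv as (A & _ & [<-|[[-> ->]|[-> ->]]]); auto.
           ++ destruct A as [Qu| ->]; auto; apply per_refl_Q; auto.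
           ++ apply ext_per_sym; auto.
        -- left; split; [apply (point_ext_le E p S (conj HE P) HS), Sp|].
           apply (ext_le_per X K e HK); intros u v Huv; apply P.
           assert (H := LT u v Huv); apply PT in H.
           destruct H as (A & _ & [<-|[[-> ->]|[-> ->]]]); auto; [tauto|].
           destruct Npq; apply ext_per_sym; auto.
      * left; apply (greatest_per S q0 H0); intros u v Huv.
        assert (H := LT u v Huv); apply PT in H.
        assert (Nu : u <> p).
        { intros ->; apply Np, (ext_per_left X K e S p v), Huv. }
        assert (Nv : v <> p).
        { intros ->; apply Np, (ext_per_left X K e S p u), ext_per_sym, Huv. }
        destruct H as (A & _ & [<-|[[-> ->]|[-> ->]]]); tauto.
Qed.

Lemma point_type_point_ext A q0 : Q q0 -> in_U A -> point_type A ->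
  exists p, target p /\ point_ext A p.
Proof.
  intros H0 HA (NG & T & HT & TA & NAT & H).
  assert (AT := proj1 (ext_le_per X K e HK T A) TA).
  assert (dom : exists p, per A p p /\ ~ Q p).
  { apply NNPP; intro N.
    assert (Adom : forall u v, per A u v -> Q u).
    { intros u v Huv; apply NNPP; intro NQ; apply N; exists u; split; auto.
      eapply ext_per_left; eauto. }
    (* then [A] identifies exactly one pair of points of [Q] *)
    assert (pair : exists a b, per A a b /\ a <> b).
    { apply NNPP; intro N'; apply NG, (greatest_per A q0 H0); intros u v Huv.
      split; [eapply Adom; eauto | apply NNPP; intro Nuv; apply N'; exists u, v; auto]. }
    destruct pair as (a & b & Aab & Nab).
    assert (Tnew : exists c d, per T c d /\ ~ per A c d).
    { apply NNPP; intro N'; apply NAT, (ext_le_per X K e HK); intros u v Huv.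
      apply NNPP; intro Nuv; apply N'; exists u, v; auto. }
    destruct Tnew as (c & d & Tcd & Ncd).
    (* A point [u] outside [Q] in the domain of [T] would give a point extension above [T] that is
       not greatest, is not above [A] and does not glue [a] to [b]: it has no place in the chain. *)
    assert (Tdom : forall u, per T u u -> Q u).
    { intros u Tu; apply NNPP; intro NQ.
      destruct (point_ext_exists u) as (E & HE & PE); [eapply per_outside; eauto|].
      assert (Euu : per E u u) by (apply PE; auto).
      destruct (H E HE) as [G|[[_ LA]|LT]].
      - apply (point_ext_le E u T (conj HE PE) HT), Tu.
      - apply (proj1 (greatest_per E q0 H0) G) in Euu; tauto.
      - apply NQ, (Adom u u), (proj1 (ext_le_per X K e HK A E) LA), Euu.
      - apply Nab, (PE a b), (proj1 (ext_le_per X K e HK E T) LT), AT, Aab. }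
    assert (Qc : Q c) by (apply Tdom, (ext_per_left X K e T c d), Tcd).
    assert (Qd : Q d) by (apply Tdom, (ext_per_left X K e T d c), ext_per_sym, Tcd).
    (* Gluing only [c] and [d] gives a member above [T] that again fits nowhere: its pair is missing
       from [A], and it cannot contain the pair [a], [b] unless the two pairs agree. *)
    destruct (per_realized_pair c d Qc Qd) as (E & HE & PE).
    assert (Ecd : per E c d) by (apply PE; split; [auto | split; auto]).
    destruct (H E HE) as [G|[[_ LA]|LT]].
    - apply (ext_le_per X K e HK); intros u v Huv; apply PE in Huv.
      destruct Huv as (Qu & _ & [<-|[[-> ->]|[-> ->]]]); auto.
      + apply per_refl_Q; auto.
      + apply ext_per_sym; auto.
    - apply (proj1 (greatest_per E q0 H0) G) in Ecd; destruct Ecd as [_ <-].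
      apply Ncd, per_refl_Q; auto.
    - apply Ncd, (proj1 (ext_le_per X K e HK A E) LA), Ecd.
    - assert (Eab : per E a b).
      { apply (proj1 (ext_le_per X K e HK E T) LT), AT, Aab. }
      apply PE in Eab; destruct Eab as (_ & _ & [E1|[[-> ->]|[-> ->]]]); auto.
      apply Ncd, ext_per_sym; auto. }
  destruct dom as (p & Ap & NQ); exists p.
  assert (Hp : target p) by (eapply per_outside; eauto).
  split; auto; split; auto.
  destruct (point_ext_exists p Hp) as (E & HE & PE).
  assert (EA : ext_le A E) by (apply (point_ext_le E p A (conj HE PE) HA), Ap).
  (* The point extension [E] lies above [A], hence above [T]; of its three possible places in the
     chain only that of [A] survives. *)
  destruct (H E HE) as [G|[[LE _]|LT]].
  - apply (point_ext_le E p T (conj HE PE) HT), AT, Ap.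
  - assert (Epp : per E p p) by (apply PE; auto).
    apply (proj1 (greatest_per E q0 H0) G) in Epp; tauto.
  - intros u v; rewrite <- PE; split; apply (ext_le_per X K e HK); auto.
  - destruct NAT; apply (ext_le_per X K e HK); intros u v Huv.
    apply (proj1 (ext_le_per X K e HK A E) EA), (proj1 (ext_le_per X K e HK E T) LT), Huv.
Qed.

(** The domain is [Q] together with the part of beta X minus [X] outside [U]; it is closed because
    [X] is open in [K]. This is how the order comes to see the topology. *)
Lemma closed_set_realized (U : K -> Prop) q0 : Q q0 -> is_open U ->
  exists E, in_U E /\ forall p, target p -> (per E p p <-> ~ U p).
Proof.
  intros H0 HU.
  destruct (per_realized (fun z => Q z \/ ((~ exists x, e x = z) /\ ~ U z)) q0 q0)
    as (E & HE & PE); auto.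
  - apply closed_union2; [apply closed_closure|].
    apply (open_ext (fun z => (exists x, e x = z) \/ U z)); [|intro; tauto].
    apply open_union2; auto; apply (image_open X K e HK LC).
  - intros x [Qx|[Nx _]]; [exact (closure_not_hewitt_image x Qx) | apply Nx; exists x; auto].
  - exists E; split; auto; intros p [NX NQ]; rewrite PE; tauto.
Qed.

End Points.

(** * Transport along an order isomorphism *)

Lemma ext_le_trans {X : Space} (E1 E2 E3 : Ext X) :
  ext_le E1 E2 -> ext_le E2 E3 -> ext_le E1 E3.
Proof.
  intros (h & Hh & Eh) (k & Hk & Ek); exists (fun y => h (k y)); split.
  - apply (continuous_comp k h); auto.
  - intro x; rewrite Ek; auto.
Qed.

Lemma ext_equiv_le {X : Space} (E1 E2 : Ext X) :
  ext_equiv E1 E2 -> ext_le E1 E2 /\ ext_le E2 E1.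
Proof.
  intros (h & k & Hh & Hk & kh & hk & E); split; [exists k | exists h]; split; auto.
  intro x; rewrite <- E; auto.
Qed.

(* An order isomorphism as a relation, so that the two sides can be exchanged. *)
Definition order_correspondence {X Y : Space} (rho : Ext X -> Ext Y -> Prop) : Prop :=
  (forall E, in_U E -> exists E', in_U E' /\ rho E E') /\
  (forall E', in_U E' -> exists E, in_U E /\ rho E E') /\
  (forall E1 E2 E1' E2', in_U E1 -> in_U E2 -> in_U E1' -> in_U E2' ->
     rho E1 E1' -> rho E2 E2' -> (ext_le E1 E2 <-> ext_le E1' E2')).

Lemma U_order_isomorphic_correspondence (X Y : Space) :
  U_order_isomorphic X Y -> exists rho : Ext X -> Ext Y -> Prop, order_correspondence rho.
Proof.
  intros (F & FU & _ & Fle & Fsurj).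
  (* [F] reaches the members of U(Y) only up to equivalence, so [E] is related to everything
     order-equivalent to [F E]. *)
  exists (fun E E' => ext_le (F E) E' /\ ext_le E' (F E)); split; [|split].
  - intros E HE; exists (F E); split; auto.
    assert (R : ext_le (F E) (F E)); [|split; auto].
    exists (fun y => y); split; auto; intros V HV; exact HV.
  - intros E' HE'; destruct (Fsurj E' HE') as (E & HE & Eq).
    exists E; split; auto; apply ext_equiv_le, Eq.
  - intros E1 E2 E1' E2' H1 H2 _ _ [A1 B1] [A2 B2]; rewrite (Fle E1 E2 H1 H2); split; intro L.
    + apply (ext_le_trans _ (F E1)); auto; apply (ext_le_trans _ (F E2)); auto.
    + apply (ext_le_trans _ E1'); auto; apply (ext_le_trans _ E2'); auto.
Qed.

Lemma order_correspondence_flip {X Y : Space} (rho : Ext X -> Ext Y -> Prop) :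
  order_correspondence rho -> order_correspondence (fun E' E => rho E E').
Proof.
  intros (A & B & C); split; [exact B | split; [exact A|]].
  intros E1 E2 E1' E2' H1 H2 H1' H2' R1 R2; symmetry; apply C; auto.
Qed.

Lemma greatest_correspondence {X Y : Space} (rho : Ext X -> Ext Y -> Prop) E E' :
  order_correspondence rho -> in_U E -> in_U E' -> rho E E' -> greatest E -> greatest E'.
Proof.
  intros (_ & B & C) HE HE' R G S' HS'; destruct (B S' HS') as (S & HS & RS).
  apply (C S E S' E'); auto.
Qed.

Lemma point_type_correspondence {X Y : Space} (rho : Ext X -> Ext Y -> Prop) A A' :
  order_correspondence rho -> in_U A -> in_U A' -> rho A A' -> point_type A -> point_type A'.
Proof.
  intros Hrho HA HA' RA (NG & T & HT & TA & NAT & H).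
  assert (Hrho' := order_correspondence_flip rho Hrho).
  assert (Hc := Hrho); destruct Hc as (tot & surj & le); split.
  - intro G; apply NG, (greatest_correspondence _ A' A Hrho'); auto.
  - destruct (tot T HT) as (T' & HT' & RT); exists T'; split; [auto | split; [|split]].
    + apply (le T A T' A'); auto.
    + intro L; apply NAT, (le A T A' T'); auto.
    + intros E' HE' L; destruct (surj E' HE') as (E & HE & RE).
      destruct (H E HE) as [G|[[L1 L2]|L1]].
      * apply (le T E T' E'); auto.
      * left; apply (greatest_correspondence rho E E'); auto.
      * right; left; split; [apply (le E A E' A') | apply (le A E A' E')]; auto.
      * right; right; apply (le E T E' T'); auto.
Qed.

Lemma closure_not_hewitt_inhabited (Z bZ : Space) (eZ : Z -> bZ) :
  stone_cech Z bZ eZ -> ~ pseudocompact Z ->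
  exists q, closure bZ (fun z => ~ in_hewitt Z bZ eZ z) q.
Proof.
  intros HZ NZ; destruct (not_pseudocompact_not_hewitt Z bZ eZ HZ NZ) as [q Nq].
  exists q; intros U _ Uq; exists q; auto.
Qed.

(** * The homeomorphism between the target sets *)

Section Homeomorphism.
Context (X Y bX bY : Space) (eX : X -> bX) (eY : Y -> bY).
Context (HX : stone_cech X bX eX) (HY : stone_cech Y bY eY).
Context (LX : locally_compact X) (LY : locally_compact Y).
Context (NX : ~ pseudocompact X) (NY : ~ pseudocompact Y).
Context (rho : Ext X -> Ext Y -> Prop) (Hrho : order_correspondence rho).

Definition point_correspondence (p : bX) (p' : bY) : Prop :=
  exists E E', rho E E' /\ point_ext X bX eX E p /\ point_ext Y bY eY E' p'.

Lemma point_correspondence_total p : target_set X bX eX p ->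
  exists p', target_set Y bY eY p' /\ point_correspondence p p'.
Proof.
  intro Hp.
  destruct (closure_not_hewitt_inhabited X bX eX HX NX) as [q Qq].
  destruct (closure_not_hewitt_inhabited Y bY eY HY NY) as [q' Qq'].
  destruct (point_ext_exists X bX eX HX LX p Hp) as (E & HE).
  destruct (proj1 Hrho E (proj1 HE)) as (E' & HE' & R).
  destruct (point_type_point_ext Y bY eY HY LY E' q' Qq' HE') as (p' & Hp' & P').
  - apply (point_type_correspondence rho E E'); auto; [apply HE|].
    apply (point_ext_point_type X bX eX HX LX E p q); auto.
  - exists p'; split; auto; exists E, E'; auto.
Qed.

(** By [point_ext_le] each side compares a member with a point extension, and [rho] respects such
    comparisons. *)
Lemma point_correspondence_le E E' p p' : point_correspondence p p' ->
  in_U E -> in_U E' -> rho E E' -> (ext_per X bX eX E p p <-> ext_per Y bY eY E' p' p').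
Proof.
  intros (A & A' & R & P & P') HE HE' RE.
  rewrite <- (point_ext_le X bX eX HX LX A p E P HE).
  rewrite <- (point_ext_le Y bY eY HY LY A' p' E' P' HE').
  apply (proj2 (proj2 Hrho)); auto; [apply P | apply P'].
Qed.

(** The point [p1] is tested on the point extension of [p2]: it belongs to the domain, which is [Q]
    with [p2] added, and it is outside [Q]. *)
Lemma point_correspondence_unique p p1 p2 : target_set Y bY eY p1 ->
  point_correspondence p p1 -> point_correspondence p p2 -> p1 = p2.
Proof.
  intros [_ NQ] C1 (E & E' & R & P & P').
  assert (H : ext_per Y bY eY E' p1 p1).
  { apply (point_correspondence_le E E' p p1); auto; [apply P | apply P' | apply P; auto]. }
  apply P' in H; destruct H as [_ [Q1|E1]]; tauto.
Qed.

(** Among target points, the complement of an open set is the domain of some [E']; its preimage is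
    then the domain of a corresponding [E], which [ext_per_domain_closed] shows to be relatively
    closed. *)
Lemma point_correspondence_continuous
    (f : sub bX (target_set X bX eX) -> sub bY (target_set Y bY eY)) :
  (forall p, point_correspondence (proj1_sig p) (proj1_sig (f p))) -> continuous f.
Proof.
  intros Hf V (U & HU & EU).
  destruct (closure_not_hewitt_inhabited Y bY eY HY NY) as [q' Qq'].
  destruct (closed_set_realized Y bY eY HY LY U q' Qq' HU) as (E' & HE' & PE').
  destruct (proj1 (proj2 Hrho) E' HE') as (E & HE & R).
  assert (key : forall p, V (f p) <-> ~ ext_per X bX eX E (proj1_sig p) (proj1_sig p)).
  { intro p; rewrite EU, (point_correspondence_le E E' _ _ (Hf p) HE HE' R).
    rewrite (PE' _ (proj2_sig (f p))); tauto. }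
  apply open_local; intros p Vp; apply key in Vp.
  destruct (ext_per_domain_closed X bX eX HX E (proj1_sig p) HE (proj1 (proj2_sig p)) Vp)
    as (W & HW & Wp & D).
  exists (fun z => W (proj1_sig z)); split; [exists W; split; [auto | tauto] | split; auto].
  intros z Wz; apply key, D, Wz.
Qed.

End Homeomorphism.

Lemma choice_sig {A B : Type} (P : A -> Prop) (P' : B -> Prop) (R : A -> B -> Prop) :
  (forall a, P a -> exists b, P' b /\ R a b) ->
  exists f : {a | P a} -> {b | P' b}, forall a, R (proj1_sig a) (proj1_sig (f a)).
Proof.
  intro H.
  assert (H' : forall a : {a | P a}, exists b : {b | P' b}, R (proj1_sig a) (proj1_sig b)).
  { intros [a Pa]; destruct (H a Pa) as (b & Pb & Rab); exists (exist _ b Pb); exact Rab. }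
  exists (fun a => proj1_sig (constructive_indefinite_description _ (H' a))).
  intro a; exact (proj2_sig (constructive_indefinite_description _ (H' a))).
Qed.

Theorem theorem2p32 :
  forall (X Y : Space),
    Tychonoff X -> Tychonoff Y ->
    locally_compact X -> locally_compact Y ->
    ~ pseudocompact X -> ~ pseudocompact Y ->
    forall (bX : Space) (eX : X -> bX), stone_cech X bX eX ->
    forall (bY : Space) (eY : Y -> bY), stone_cech Y bY eY ->
    U_order_isomorphic X Y ->
    homeomorphic (sub bX (target_set X bX eX)) (sub bY (target_set Y bY eY)).
Proof.
  intros X Y _ _ LX LY NX NY bX eX HX bY eY HY Hiso.
  destruct (U_order_isomorphic_correspondence X Y Hiso) as [rho Hrho].
  assert (Hrho' := order_correspondence_flip rho Hrho).
  set (PC := point_correspondence X Y bX bY eX eY rho).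
  set (PC' := point_correspondence Y X bY bX eY eX (fun E' E => rho E E')).
  assert (flip : forall p p', PC p p' <-> PC' p' p).
  { intros p p'; split; intros (E & E' & R & P & P'); exists E', E; auto. }
  destruct (choice_sig (target_set X bX eX) (target_set Y bY eY) PC) as [f Hf].
  { apply point_correspondence_total; auto. }
  destruct (choice_sig (target_set Y bY eY) (target_set X bX eX) PC') as [g Hg].
  { apply point_correspondence_total; auto. }
  assert (sig_eq : forall (S : Space) (A : S -> Prop) (x y : sub S A),
            proj1_sig x = proj1_sig y -> x = y).
  { intros S A [x hx] [y hy] E; simpl in E; subst; f_equal; apply proof_irrelevance. }
  exists f, g; split; [|split; [|split]].
  - apply (point_correspondence_continuous X Y bX bY eX eY HX HY LX LY NY rho Hrho), Hf.
  - apply (point_correspondence_continuous Y X bY bX eY eX HY HX LY LX NX _ Hrho'), Hg.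
  - intro p; apply sig_eq.
    apply (point_correspondence_unique Y X bY bX eY eX HY HX LY LX _ Hrho' (proj1_sig (f p)));
      [exact (proj2_sig (g (f p))) | apply Hg | apply flip, Hf].
  - intro p; apply sig_eq.
    apply (point_correspondence_unique X Y bX bY eX eY HX HY LX LY _ Hrho (proj1_sig (g p)));
      [exact (proj2_sig (f (g p))) | apply Hf | apply flip, Hg].
Qed.
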